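(* Let $m\ge2$ and $k\ge 3$ be integers. For $3\le l\le k$ let $\mathcal{UC}(l;k)$ be the collection of connected linear $m$-uniform unicyclic hypergraphs in $\mathcal{P}(\mathcal{H})$ with $k$ edges whose cycle has length $l$, and let $UC^*_l\in\mathcal{UC}(l;k)$ be such that $\lambda_1(UC^*_l)=\max\{\lambda_1(\mathcal{H})\mid \mathcal{H}\in\mathcal{UC}(l;k)\}$. Then: (i) $UC^*_l=UC_l(c_1=k-l)$, and $\lambda_1(U)<\lambda_1(UC_l(c_1=k-l))$ for every other $U\in\mathcal{UC}(l;k)$. (ii) $\dfrac{m-1+\sqrt{m^2+6m-7}}{2m-2}\le\lambda_1(UC^*_l)$ for all $3\le l\le k$, with equality only when $UC^*_l=C_L(k)$; and $\lambda_1(UC^*_l)<\lambda_1(UC^*_{l-1})$ for all $4\le l\le k$. (iii) $\dfrac{m-2+\sqrt{(m-2)^2+4(k-l+2)(m-1)}}{2(m-1)}<\lambda_1(UC_l(c_1=k-l))<\dfrac{m+\sqrt{m^2+4(k-l+2)(m-1)}}{2(m-1)}.$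
   Context: A hypergraph has a finite vertex set and an edge set of non-empty subsets of the vertex set; it is $m$-uniform if all edges have cardinality $m$, and linear if two distinct edges share at most one vertex. The adjacency matrix of a linear $m$-uniform hypergraph $\mathcal{H}$ has $(i,j)$ entry $\frac{1}{m-1}$ if $i\ne j$ lie in a common edge, and $0$ otherwise; $\lambda_1(\mathcal{H})$ denotes its spectral radius. The $m$-th power hypergraph of a graph $G(V,E)$ is the $m$-uniform hypergraph obtained by adding to each edge $e\in E$ $m-2$ new vertices $v_{e,1},\dots,v_{e,m-2}$ (distinct for distinct edges). $\mathcal{P}(\mathcal{H})$ denotes the set of $m$-th power hypergraphs of graphs. A loose cycle of length $l\ge3$, $C_L(l)=v_1e_1v_2e_2\dots v_le_lv_1$, is the $m$-uniform hypergraph with edges $e_1,\dots,e_l$ in which $e_{i-1}\cap e_i=\{v_i\}$ (indices mod $l$, the $v_i$ distinct) and non-consecutive edges are disjoint; $v_1,\dots,v_l$ are its core vertices. A linear hypergraph is unicyclic if it contains exactly one loose cycle. Attaching a pendant edge at a vertex $v$ means adding a new edge consisting of $v$ and $m-1$ new vertices. $UC_l(c_1,\dots,c_l)$ is obtained from $C_L(l)$ by attaching $c_i$ pendant edges at $v_i$ for $i=1,\dots,l$; when only some of the $c_i$ are listed, the others are $0$. Equality of hypergraphs means isomorphism. *)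

(* Defs.v *)
From HB Require Import structures.
From mathcomp Require Import all_boot all_order all_algebra.
From mathcomp Require Import complex.
From mathcomp Require Import reals.

Set Implicit Arguments.
Unset Strict Implicit.
Unset Printing Implicit Defensive.

Import Order.TTheory GRing.Theory Num.Theory.
Local Open Scope ring_scope.

Record hypergraph := Hypergraph {
  hvert :> finType;
  hedge : {set {set hvert}};
  hedge_neq0 : set0 \notin hedge }.

Definition uniform (m : nat) (H : hypergraph) : Prop :=
  forall e, e \in hedge H -> #|e| = m.

Definition linear_hg (H : hypergraph) : Prop :=
  forall e f, e \in hedge H -> f \in hedge H -> e != f -> (#|e :&: f| <= 1)%N.

Definition hadj (H : hypergraph) : rel H :=
  fun u v => (u != v) && [exists e in hedge H, (u \in e) && (v \in e)].

Definition connected_hg (H : hypergraph) : Prop :=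
  forall u v : H, connect (@hadj H) u v.

Definition hiso (H K : hypergraph) : Prop :=
  exists2 f : H -> K, bijective f &
    forall e : {set H}, (e \in hedge H) = (f @: e \in hedge K).

Definition adjmx (R : realType) (m : nat) (H : hypergraph) : 'M[R]_#|H| :=
  \matrix_(i, j)
    if hadj (enum_val i) (enum_val j) then (m%:R - 1)^-1 else 0.

(* sup {|z| : z a complex eigenvalue of A} *)
Definition spectral_radius (R : realType) (n : nat) (A : 'M[R]_n) : R :=
  sup (fun x : R => exists2 z : R[i],
    eigenvalue (map_mx (real_complex R) A) z & `|z| = real_complex R x).

Definition lambda1 (R : realType) (m : nat) (H : hypergraph) : R :=
  spectral_radius (adjmx R m H).

Section Power.
Variables (m : nat) (G : hypergraph).

Definition pow_vert : finType :=
  (G + {e : {set G} | e \in hedge G} * 'I_(m - 2))%type.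

Definition pow_edge (e : {e : {set G} | e \in hedge G}) : {set pow_vert} :=
  [set inl v | v in val e] :|: [set inr (e, j) | j : 'I_(m - 2)].

Lemma pow_edge_neq0 :
  set0 \notin [set pow_edge e | e : {e : {set G} | e \in hedge G}].
Proof.
apply/imsetP => -[[e eG] _ /setP E].
have [e0|[v ve]] := set_0Vmem e; first by have := hedge_neq0 G; rewrite -e0 eG.
by have := E (inl v); rewrite !inE imset_f.
Qed.

Definition power_hg : hypergraph := Hypergraph pow_edge_neq0.
End Power.

(* A finite simple graph is a 2-uniform hypergraph. *)
Definition in_powers (m : nat) (H : hypergraph) : Prop :=
  exists G : hypergraph, uniform 2 G /\ hiso H (power_hg m G).

(* S is the edge set of a loose cycle of length l contained in H; a loose cycle
   of H is identified with its edge set, so that rotating or reversing the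
   enumeration v_1 e_1 ... v_l e_l does not produce a different cycle. *)
Definition loose_cycle_in (H : hypergraph) (l : nat) (S : {set {set H}}) : Prop :=
  [/\ (3 <= l)%N, S \subset hedge H &
   exists (v : 'I_l -> H) (e : 'I_l -> {set H}),
     [/\ injective v, injective e, S = [set e i | i : 'I_l],
         forall i, e (ord_pred i) :&: e i = [set v i] &
         forall i j, j != i -> j != ordS i -> i != ordS j ->
           [disjoint e i & e j]]].

Definition unicyclic (H : hypergraph) : Prop :=
  exists! S : {set {set H}}, exists l, loose_cycle_in l S.

Definition in_UC (m l k : nat) (H : hypergraph) : Prop :=
  [/\ connected_hg H, linear_hg H, uniform m H &
      [/\ unicyclic H, in_powers m H, #|hedge H| = k &
          exists S : {set {set H}}, loose_cycle_in l S]].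

Definition is_UCstar (R : realType) (m l k : nat) (U : hypergraph) : Prop :=
  in_UC m l k U /\
  forall H, in_UC m l k H -> lambda1 R m H <= lambda1 R m U.

Section LooseCycle.
Variables (m l : nat).

(* inl i is the i-th core vertex; the inr (i, _) are the remaining m - 2
   vertices of the i-th edge, which joins the core vertices i and i + 1. *)
Definition lc_vert : finType := ('I_l + 'I_l * 'I_(m - 2))%type.

Definition lc_edge (i : 'I_l) : {set lc_vert} :=
  [set inl i; inl (ordS i)] :|: [set inr (i, j) | j : 'I_(m - 2)].

Lemma lc_edge_neq0 : set0 \notin [set lc_edge i | i : 'I_l].
Proof.
apply/imsetP => -[i _ /setP/(_ (inl i))].
by rewrite !inE eqxx.
Qed.

Definition C_L : hypergraph := Hypergraph lc_edge_neq0.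
End LooseCycle.

Section Attach.
Variables (m : nat) (H : hypergraph) (c : H -> nat).

Definition att_vert : finType :=
  (H + {v : H & 'I_(c v)} * 'I_(m - 1))%type.

Definition att_edge (p : {v : H & 'I_(c v)}) : {set att_vert} :=
  inl (tag p) |: [set inr (p, t) | t : 'I_(m - 1)].

Definition att_edges : {set {set att_vert}} :=
  [set [set inl v | v in e] | e : {set H} in hedge H] :|:
  [set att_edge p | p : {v : H & 'I_(c v)}].

Lemma att_edges_neq0 : set0 \notin att_edges.
Proof.
rewrite inE negb_or; apply/andP; split; apply/imsetP.
- move=> [e eH /setP E].
  have [e0|[v ve]] := set_0Vmem e; first by have := hedge_neq0 H; rewrite -e0 eH.
  by have := E (inl v); rewrite !inE imset_f.
- by move=> [p _ /setP/(_ (inl (tag p)))]; rewrite !inE eqxx.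
Qed.

(* H with c v pendant edges attached at every vertex v. *)
Definition attach_pendant : hypergraph := Hypergraph att_edges_neq0.
End Attach.

Definition UC_hg (m l : nat) (c : 'I_l -> nat) : hypergraph :=
  attach_pendant m (H := C_L m l)
    (fun v : lc_vert m l => match v with inl i => c i | inr _ => 0%N end).

(* UC_l(c_1 = c), the other c_i being 0; the first core vertex has index 0. *)
Definition UC1_hg (m l c : nat) : hypergraph :=
  UC_hg m (fun i : 'I_l => if val i == 0%N then c else 0%N).

(* Main.v *)
(* Let x be a Perron vector of U, the m-th power of a unicyclic graph G, and let w
   be a vertex of G at which x is maximal.  Every edge of G, except the cycle edges
   away from the cycle vertex c nearest to w, has an endpoint that is w or can be
   moved to w, so that the result is UC_l(c_1 = k - l) with centre w: at c the two cycle edges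
   are moved, and every tree edge keeps its endpoint farther from w.  Since
   x_w is maximal, no move decreases the Rayleigh quotient of x; if no move
   increases it, the eigenvalue equations at w force that nothing was moved.  Moving
   one further cycle edge to w shortens the cycle.  The numerical bounds come from
   explicit test vectors: constant on the graph vertices and on the added vertices
   for (ii), and supported on the star at the centre, respectively constant on the
   cycle, for (iii). *)

Require Import Defs.
From HB Require Import structures.
From mathcomp Require Import all_boot all_order all_algebra.
From mathcomp Require Import complex.
From mathcomp Require Import reals.
From mathcomp Require Import ring lra zify.

Set Implicit Arguments.
Unset Strict Implicit.
Unset Printing Implicit Defensive.

Import Order.TTheory GRing.Theory Num.Theory.
Local Open Scope ring_scope.

(** * The dominant eigenvalue of a symmetric nonnegative matrix *)

(** Moving the endpoint $p$ of an edge to $w$ raises the quadratic form of that edge by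
    $2(x_w-x_p)(S-x_p)$, where $S$ is the sum of $x$ over the edge. This vanishes when $x_p=x_w$, so
    strictness cannot come from the form; at $w$, however, each moved edge adds $S-x_p>0$ to the
    eigenvalue equation. Only graph vertices are moved, so added vertices may carry larger values.
    All moves happen at once, on graphs given as edge families over the same index types, so that
    one vector tests both. Unicyclicity enters through $|E|\le|V|$: it makes the number of vertices
    off the rooted part equal to the number of tree edges. With $\mu=(m-1)\lambda_1$, the bound of
    (ii) is the radius of a loose cycle: a unicyclic graph has as many edges as vertices, so a
    vector constant on each of the two kinds of vertices has the same Rayleigh quotient for every
    shape. The lower bound of (iii) is the radius of a star with $k-l+2$ edges; the upper one makes
    an explicit positive vector a supersolution. *)

Section UnitaryNorm.
Local Open Scope sesquilinear_scope.
Variables (C : numClosedFieldType) (n : nat).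
Implicit Types (v : 'rV[C]_n) (P : 'M[C]_n).

Definition sqnorm v : C := \sum_j `|v 0 j| ^+ 2.

Lemma sqnormE v : sqnorm v = (v *m v ^t*) 0 0.
Proof. by rewrite mxE; apply: eq_bigr => j _; rewrite !mxE normCK. Qed.

Lemma sqnorm_unitary v P : P \is unitarymx -> sqnorm (v *m P) = sqnorm v.
Proof.
move=> uP; rewrite !sqnormE trmx_mul map_mxM mulmxA -[v *m P *m _]mulmxA.
by rewrite (unitarymxP uP) mulmx1.
Qed.
End UnitaryNorm.

Section SymmetricSpectrum.
Local Open Scope complex_scope.
Variables (R : realType) (n : nat) (A : 'M[R]_n).
Hypotheses (n_gt0 : (0 < n)%N) (symA : A^T = A).
Let M := map_mx (real_complex R) A.
Let P := spectralmx M.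
Let d := spectral_diag M.

Let uP : P \is unitarymx. Proof. exact: spectral_unitarymx. Qed.

Let PM : P *m M = diag_mx d *m P.
Proof.
have /orthomx_spectralP {1}-> : M \is normalmx.
  apply/hermitian_normalmx/realsym_hermsym.
    by apply/is_hermitianmxP; rewrite expr0 scale1r map_mx_id //= map_trmx symA.
  by apply/mxOverP => i j; rewrite mxE complex_real.
by rewrite -mulmxA mulKVmx // spectral_unit.
Qed.

(** The matrix is real symmetric, so $u\mapsto uM$ scales the coordinates of $u$ in the unitary
    basis [P] by the entries of [d]. The largest modulus of an entry is attained at a row of [P] and
    bounds the map. *)
Lemma spectral_radius_witness :
  exists2 v : 'rV[R[i]]_n, v != 0 &
  exists2 z : R[i], v *m M = z *: v &
    `|z| = (spectral_radius A)%:C /\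
    forall u, sqnorm (u *m M) <= `|z| ^+ 2 * sqnorm u.
Proof.
pose r j := Normc.normc (d 0 j).
have rE j : `|d 0 j| = (r j)%:C by [].
pose i0 := [arg max_(i > Ordinal n_gt0) r i]%O.
have ri0 j : r j <= r i0 by rewrite /i0; case: arg_maxP => // i _; apply.
have rowdP j : row j P *m M = d 0 j *: row j P.
  by rewrite -row_mul PM mul_diag_mx; apply/rowP => i; rewrite !mxE.
have rowN0 j : row j P != 0.
  apply/eqP => r0; have /row_unitarymxP/(_ j j) := uP.
  by rewrite r0 linear0l eqxx => /eqP; rewrite eq_sym oner_eq0.
have eig j : eigenvalue M (d 0 j).
  by apply/eigenvalueP; exists (row j P).
have eigd z : eigenvalue M z -> exists j, z = d 0 j.
  case/eigenvalueP => v vM vN0.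
  pose y := v *m invmx P.
  have yd : y *m diag_mx d = z *: y.
    rewrite /y -[diag_mx d](mulmxK (spectral_unit M)) -PM.
    by rewrite !mulmxA mulmxKV ?spectral_unit // vM -scalemxAl.
  have yN0 : y != 0.
    apply: contraNneq vN0 => y0.
    by rewrite -[v](mulmxKV (spectral_unit M)) -/P -/y y0 mul0mx.
  have /rV0Pn[j yj] := yN0; exists j.
  move/rowP/(_ j): yd; rewrite mul_mx_diag mxE [RHS]mxE mulrC => H.
  exact/esym/(mulIf yj).
exists (row i0 P) => //; exists (d 0 i0) => //; split; last first.
  move=> u; pose y := u *m invmx P.
  have -> : u = y *m P by rewrite mulmxKV ?spectral_unit.
  rewrite -mulmxA PM mulmxA !(sqnorm_unitary _ uP) /sqnorm mulr_sumr.
  apply: ler_sum => j _; rewrite mul_mx_diag !mxE normrM exprMn mulrC.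
  rewrite ler_wpM2r ?exprn_ge0 // lerXn2r ?nnegrE // !rE lecR; exact: ri0.
rewrite rE; congr (_ %:C); apply/eqP; rewrite eq_le; apply/andP; split.
  apply: ub_le_sup.
    exists (r i0) => x [z /eigd[j ->]]; rewrite rE => /complexI <-; exact: ri0.
  by exists (d 0 i0).
apply: ge_sup; first by exists (r i0), (d 0 i0).
by move=> x [z /eigd[j ->]]; rewrite rE => /complexI <-; exact: ri0.
Qed.

(* The moduli [x] of a dominant eigenvector satisfy [A x >= rho x] entrywise,
   while [A] is [rho]-Lipschitz for the Euclidean norm: equality everywhere. *)
Lemma nonneg_eigenvector : (forall i j, 0 <= A i j) ->
  exists x : 'I_n -> R, [/\ forall i, 0 <= x i, exists i, x i != 0 &
    forall i, \sum_j A i j * x j = spectral_radius A * x i].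
Proof.
move=> A0; have [v /rV0Pn[i0 vi0] [z vM]] := spectral_radius_witness.
set rho := spectral_radius A => -[zE zmax].
have rho0 : 0 <= rho by rewrite -lecR -zE normr_ge0.
pose x i := Normc.normc (v 0 i).
have xE i : `|v 0 i| = (x i)%:C by [].
have x0 i : 0 <= x i by rewrite -lecR -xE normr_ge0.
have xi0 : x i0 != 0.
  apply: contraNneq vi0 => xi; have := xE i0; rewrite xi => /eqP.
  by rewrite normr_eq0.
pose y i := \sum_j A i j * x j.
have yx i : rho * x i <= y i.
  rewrite -lecR rmorphM /= -zE -xE -normrM.
  have := congr1 (fun w : 'rV_n => w 0 i) vM; rewrite !mxE => <-.
  apply: le_trans (ler_norm_sum _ _ _) _; rewrite rmorph_sum /=.
  apply: ler_sum => j _; rewrite !mxE normrM xE rmorphM /= mulrC.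
  have -> : A i j = A j i by rewrite -[in LHS]symA mxE.
  by rewrite ger0_norm // lecR.
have le_sq : \sum_i y i ^+ 2 <= rho ^+ 2 * \sum_i x i ^+ 2.
  have := zmax (\row_i (x i)%:C); rewrite zE /sqnorm => le.
  rewrite -lecR rmorphM rmorphXn /= !rmorph_sum /=.
  have e1 : \sum_(i < n) (x i ^+ 2)%:C = \sum_j `|(\row_i (x i)%:C) 0 j| ^+ 2.
    by apply: eq_bigr => j _; rewrite mxE ger0_norm ?lecR // rmorphXn.
  rewrite e1; apply: le_trans le; rewrite le_eqVlt; apply/orP; left; apply/eqP.
  apply: eq_bigr => j _; rewrite !mxE rmorphXn /=; congr (_ ^+ 2).
  have -> : \sum_j0 (\row_i (x i)%:C) 0 j0 * M j0 j = (y j)%:C.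
    rewrite rmorph_sum /=; apply: eq_bigr => k _; rewrite !mxE rmorphM mulrC /=.
    by rewrite -{1}symA mxE.
  rewrite ger0_norm // lecR; apply: sumr_ge0 => k _; exact: mulr_ge0.
have sq_le i : (rho * x i) ^+ 2 <= y i ^+ 2.
  rewrite lerXn2r ?nnegrE //; first exact: mulr_ge0.
  by apply: le_trans (yx i); exact: mulr_ge0.
exists x; split=> //; first by exists i0.
move=> i; apply/eqP; rewrite eq_sym -(@eqrXn2 _ 2) //; last 2 first.
- exact: mulr_ge0.
- by apply: le_trans (yx i); exact: mulr_ge0.
have gap0 j : true -> 0 <= y j ^+ 2 - (rho * x j) ^+ 2 by rewrite subr_ge0.
have /(psumr_eq0P gap0)/(_ i isT)/eqP :
    \sum_j (y j ^+ 2 - (rho * x j) ^+ 2) = 0; last by rewrite subr_eq0 eq_sym.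
apply/eqP; rewrite eq_le sumr_ge0 // andbT sumrB subr_le0.
by under [leRHS]eq_bigr do rewrite exprMn; rewrite -mulr_sumr.
Qed.
End SymmetricSpectrum.

(** * Perron vectors and Rayleigh quotients of hypergraphs *)

Lemma hadj_sym (H : hypergraph) (u v : H) : hadj u v = hadj v u.
Proof.
rewrite /hadj eq_sym; congr (_ && _).
by apply: eq_existsb => e; rewrite [(v \in e) && _]andbC.
Qed.

Section Perron.
Variables (R : realType) (m : nat) (H : hypergraph).
Hypotheses (m_ge2 : (2 <= m)%N) (H_gt0 : (0 < #|H|)%N) (Hc : connected_hg H).

Definition adjop (X : H -> R) (u : H) : R := \sum_v (hadj u v)%:R * X v.

(* [adjmx] is [adjop] divided by [m - 1], so [mu] is the spectral radius of [adjop]. *)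
Definition mu : R := (m%:R - 1) * lambda1 R m H.

Let m1_gt0 : 0 < m%:R - 1 :> R.
Proof. by rewrite subr_gt0 ltr1n. Qed.

Lemma adjop_sym (X Y : H -> R) :
  \sum_u X u * adjop Y u = \sum_u Y u * adjop X u.
Proof.
under eq_bigr do rewrite mulr_sumr.
rewrite exchange_big; apply: eq_bigr => u _; rewrite mulr_sumr.
by apply: eq_bigr => v _; rewrite hadj_sym; ring.
Qed.

(** At a zero of the nonnegative eigenvector the values at all neighbours sum to zero, hence vanish;
    connectedness would spread the zero everywhere. *)
Lemma perron : exists w : H -> R,
  (forall u, 0 < w u) /\ forall u, adjop w u = mu * w u.
Proof.
have symA : (adjmx R m H)^T = adjmx R m H.
  by apply/matrixP => i j; rewrite !mxE hadj_sym.
have A0 i j : 0 <= adjmx R m H i j.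
  by rewrite mxE; case: ifP => // _; rewrite invr_ge0 ltW.
have [x [x0 [i0 xi0] xA]] := nonneg_eigenvector H_gt0 symA A0.
pose w u := x (enum_rank u).
have wA u : adjop w u = mu * w u.
  rewrite /mu -mulrA -xA mulr_sumr.
  rewrite /adjop (reindex_onto (@enum_val H H) enum_rank) /=; last first.
    by move=> v _; rewrite enum_rankK.
  apply: eq_big => [i|i _]; first by rewrite enum_valK eqxx.
  rewrite mxE enum_rankK /w enum_valK; case: hadj; last by rewrite !mul0r mulr0.
  by rewrite mul1r mulrA divff ?mul1r ?gt_eqF.
exists w; split => // u; rewrite lt_neqAle x0 andbT eq_sym.
pose Z := [pred v | w v == 0].
have Zstep u1 v1 : hadj u1 v1 -> w u1 = 0 -> w v1 = 0.
  move=> uv wu; have := wA u1; rewrite wu mulr0 => /psumr_eq0P.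
  move=> /(_ (fun v _ => mulr_ge0 (ler0n _ _) (x0 _)))/(_ v1 isT).
  by rewrite uv mul1r.
have Zc : closed (@hadj H) Z.
  move=> u1 v1 uv; rewrite !inE; apply/eqP/eqP; first exact: Zstep.
  by apply: Zstep; rewrite hadj_sym.
have /(closed_connect Zc) := Hc u (enum_val i0); rewrite !inE /w => ->.
by rewrite enum_valK.
Qed.

(** Pairing with a Perron vector $w$, by symmetry, gives $r\langle w,X\rangle=\mu\langle w,X\rangle$
    with a positive pairing. *)
Lemma mu_unique (r : R) (X : H -> R) :
  (forall u, 0 < X u) -> (forall u, adjop X u = r * X u) -> r = mu.
Proof.
move=> X0 XA; have [w [w0 wA]] := perron.
have := adjop_sym w X.
under eq_bigr do rewrite XA mulrCA.
under [RHS]eq_bigr do rewrite wA mulrCA [X _ * _]mulrC.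
rewrite -!mulr_sumr => /mulIf; apply; rewrite gt_eqF //.
have [u _] : exists u : H, u \in H by apply/card_gt0P.
rewrite (bigD1 u) //= ltr_pwDl ?mulr_gt0 // sumr_ge0 // => v _.
by rewrite ltW ?mulr_gt0.
Qed.

(** The same pairing; one strict inequality suffices because the Perron vector is positive
    everywhere. *)
Lemma mu_lt_super (r : R) (X : H -> R) (u0 : H) :
  (forall u, 0 < X u) -> (forall u, adjop X u <= r * X u) ->
  adjop X u0 < r * X u0 -> mu < r.
Proof.
move=> X0 XA lt0; have [w [w0 wA]] := perron.
have s0 : 0 < \sum_u w u * X u.
  rewrite (bigD1 u0) //= ltr_pwDl ?mulr_gt0 // sumr_ge0 // => v _.
  by rewrite ltW ?mulr_gt0.
rewrite -(ltr_pM2r s0) !mulr_sumr.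
have <- : \sum_u w u * adjop X u = \sum_i mu * (w i * X i).
  by rewrite adjop_sym; apply: eq_bigr => u _; rewrite wA; ring.
rewrite [ltLHS](bigD1 u0) //= [ltRHS](bigD1 u0) //= ltr_leD //.
  by rewrite mulrCA ltr_pM2l.
by apply: ler_sum => u _; rewrite mulrCA ler_pM2l.
Qed.

Lemma mu_gt_sub (r : R) (X : H -> R) (u0 : H) :
  (forall u, 0 <= X u) -> (forall u, r * X u <= adjop X u) ->
  r * X u0 < adjop X u0 -> r < mu.
Proof.
move=> X0 XA lt0; have [w [w0 wA]] := perron.
have s0 : 0 <= \sum_u w u * X u.
  by apply: sumr_ge0 => u _; rewrite mulr_ge0 // ltW.
suff : r * (\sum_u w u * X u) < mu * (\sum_u w u * X u).
  (* [X] is only nonnegative, so the pairing could be 0; the strict inequality would then read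
     $0<0$. *)
  rewrite le_eqVlt in s0; case/orP: s0 => [/eqP <-|s0].
    by rewrite !mulr0 ltxx.
  by rewrite ltr_pM2r.
rewrite !mulr_sumr.
have <- : \sum_u w u * adjop X u = \sum_i mu * (w i * X i).
  by rewrite adjop_sym; apply: eq_bigr => u _; rewrite wA; ring.
rewrite [ltLHS](bigD1 u0) //= [ltRHS](bigD1 u0) //= ltr_leD //.
  by rewrite mulrCA ltr_pM2l.
by apply: ler_sum => u _; rewrite mulrCA ler_pM2l.
Qed.

(* With a Perron vector [w], the form [mu |X|^2 - <X, A X>] is the Dirichlet
   energy of [X / w]. *)
Lemma dirichlet (X : H -> R) : exists2 w : H -> R, (forall u, 0 < w u) &
  (mu * (\sum_u X u ^+ 2) - \sum_u X u * adjop X u) *+ 2 =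
  \sum_u \sum_v (hadj u v)%:R * (w u * w v * (X u / w u - X v / w v) ^+ 2)
  /\ forall u, adjop w u = mu * w u.
Proof.
have [w [w0 wA]] := perron; exists w => //; split => //.
have wN0 u : w u != 0 by rewrite gt_eqF.
have e1 : \sum_u \sum_v (hadj u v)%:R * (w v * (X u ^+ 2 / w u)) =
    mu * \sum_u X u ^+ 2.
  rewrite mulr_sumr; apply: eq_bigr => u _.
  under eq_bigr do rewrite mulrA.
  rewrite -mulr_suml -/(adjop w u) wA; by field.
have e2 : \sum_u \sum_v (hadj u v)%:R * (w u * (X v ^+ 2 / w v)) =
    mu * \sum_u X u ^+ 2.
  rewrite -e1 exchange_big; apply: eq_bigr => u _; apply: eq_bigr => v _.
  by rewrite hadj_sym.
rewrite mulrnBl -[X in X - _]mulr2n mulr2n -{1}e1 -e2 -big_split /=.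
have -> : (\sum_u X u * adjop X u) *+ 2 =
    \sum_u \sum_v (hadj u v)%:R * (X u * X v *+ 2).
  rewrite -sumrMnl; apply: eq_bigr => u _; rewrite mulr_sumr -sumrMnl.
  by apply: eq_bigr => v _; ring.
rewrite -sumrB; apply: eq_bigr => u _.
rewrite -big_split /= -sumrB; apply: eq_bigr => v _.
by field; rewrite !wN0.
Qed.

Lemma rayleigh (X : H -> R) :
  \sum_u X u * adjop X u <= mu * \sum_u X u ^+ 2.
Proof.
have [w w0 [E _]] := dirichlet X; rewrite -subr_ge0 -(@pmulrn_lge0 _ _ 2) // E.
apply: sumr_ge0 => u _; apply: sumr_ge0 => v _.
by rewrite mulr_ge0 ?ler0n // mulr_ge0 ?sqr_ge0 // mulr_ge0 // ltW.
Qed.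

(** Equality makes the Dirichlet energy vanish, so [X / w] agrees at adjacent vertices, and the
    eigenvalue equation of [w] scaled by this ratio is that of [X]. *)
Lemma rayleigh_eq (X : H -> R) :
  \sum_u X u * adjop X u = mu * \sum_u X u ^+ 2 ->
  forall u, adjop X u = mu * X u.
Proof.
have [w w0 [+ wA]] := dirichlet X => E XE.
have wN0 u : w u != 0 by rewrite gt_eqF.
have t0 u v : 0 <= (hadj u v)%:R * (w u * w v * (X u / w u - X v / w v) ^+ 2).
  by rewrite mulr_ge0 ?ler0n // mulr_ge0 ?sqr_ge0 // mulr_ge0 // ltW.
move: E; rewrite XE subrr mul0rn => /esym/psumr_eq0P E.
move=> u; have {}E : \sum_v (hadj u v)%:R * (w u * w v * (X u / w u - X v / w v) ^+ 2) = 0.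
  by apply: E => // u' _; apply: sumr_ge0.
rewrite /adjop -[X u](divfK (wN0 u)) [_ / _ * _]mulrC mulrA -wA mulr_suml.
apply: eq_bigr => v _.
move/psumr_eq0P: E => /(_ (fun v _ => t0 u v))/(_ v isT); case: hadj; last by rewrite !mul0r.
rewrite !mul1r => /eqP; rewrite mulf_eq0 (mulf_eq0 (w u)) !(negPf (wN0 _)) /=.
by rewrite sqrf_eq0 subr_eq0 => /eqP ->; field.
Qed.
End Perron.

(** * Power hypergraphs and moving edges *)

(** Edges are indexed rather than collected in a set, so that an edge keeps its name when an
    endpoint is moved. *)
Definition simple_ends (V E : finType) (ends : E -> {set V}) : Prop :=
  (forall e, #|ends e| = 2) /\ injective ends.

Section PowerOfEnds.
Variables (m : nat) (V E : finType) (ends : E -> {set V}).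

Definition ph_vert : finType := (V + E * 'I_(m - 2))%type.

Definition ph_edge (e : E) : {set ph_vert} :=
  [set inl v | v in ends e] :|: [set inr (e, j) | j : 'I_(m - 2)].

Definition ph_edges := [set ph_edge e | e : E] :\ set0.

Lemma ph_edges_neq0 : set0 \notin ph_edges.
Proof. by rewrite !inE eqxx. Qed.

(* [power_hg] for a graph given by an indexed family of edges; deleting [set0]
   makes the construction total and is vacuous for a simple graph. *)
Definition ph : hypergraph := Hypergraph ph_edges_neq0.

Lemma mem_ph_edge_inl v e : (inl v \in ph_edge e) = (v \in ends e).
Proof.
rewrite inE mem_imset; last by move=> ? ? [].
by case: imsetP => [[]|] //; rewrite orbF.
Qed.

Lemma mem_ph_edge_inr e' j e : (inr (e', j) \in ph_edge e) = (e' == e).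
Proof.
rewrite inE; apply/orP/eqP => [[/imsetP[]//|/imsetP[? _ []]]//|->].
by right; apply/imsetP; exists j.
Qed.

Definition mem_ph_edge := (mem_ph_edge_inl, mem_ph_edge_inr).

Lemma ph_edge_sum (T : nmodType) (X : ph_vert -> T) e :
  \sum_(u in ph_edge e) X u =
  \sum_(v in ends e) X (inl v) + \sum_j X (inr (e, j)).
Proof.
rewrite big_sumType /=; congr (_ + _).
  by apply: eq_bigl => v; rewrite mem_ph_edge.
rewrite (reindex_omap (fun j => (e, j)) (fun p => if p.1 == e then Some p.2 else None)) /=.
  by apply: eq_bigl => j; rewrite mem_ph_edge !eqxx.
by move=> [e' j]; rewrite mem_ph_edge => /eqP -> /=; rewrite eqxx.
Qed.

Hypothesis simpleG : simple_ends ends.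

Lemma ph_edge_inj : injective ph_edge.
Proof.
move=> e e' eq_e; apply: simpleG.2; apply/setP => v.
by rewrite -!mem_ph_edge_inl eq_e.
Qed.

Lemma mem_hedge_ph (A : {set ph}) :
  reflect (exists e, A = ph_edge e) (A \in hedge ph).
Proof.
apply: (iffP idP) => [|[e ->]].
  by rewrite !inE => /andP[_ /imsetP[e _ ->]]; exists e.
rewrite !inE imset_f // andbT; apply/set0Pn.
have : (0 < #|ends e|)%N by rewrite simpleG.1.
by move=> /card_gt0P[v ve]; exists (inl v); rewrite mem_ph_edge.
Qed.

(** An added vertex names its edge; two graph vertices determine theirs because there are no
    parallel edges. *)
Lemma ph_edge_meet e e' u v : u != v -> u \in ph_edge e -> v \in ph_edge e ->
  u \in ph_edge e' -> v \in ph_edge e' -> e = e'.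
Proof.
case: u v => [u|[f j]] [v|[f' j']]; rewrite !mem_ph_edge; last 3 first.
- by move=> _ _ /eqP <- _ /eqP <-.
- by move=> _ /eqP <- _ /eqP <-.
- by move=> _ /eqP <- _ /eqP <-.
move=> uv ue ve ue' ve'; apply: simpleG.2.
have {}uv : u != v by apply: contra_neq uv => ->.
have sub e1 : u \in ends e1 -> v \in ends e1 -> ends e1 = [set u; v].
  move=> u1 v1; apply/esym/eqP.
  by rewrite eqEcard cards2 uv simpleG.1 leqnn andbT subUset !sub1set u1.
by rewrite (sub e) // (sub e').
Qed.

Lemma hadj_ph (u v : ph) :
  hadj u v = (u != v) && [exists e, (u \in ph_edge e) && (v \in ph_edge e)].
Proof.
rewrite /hadj; congr (_ && _).
apply/existsP/existsP => [[A /andP[/mem_hedge_ph[e ->] AA]]|[e ee]].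
  by exists e.
by exists (ph_edge e); rewrite ee andbT; apply/mem_hedge_ph; exists e.
Qed.

Variable R : realType.
Implicit Type X : ph -> R.

(** By [ph_edge_meet] every neighbour of [u] shares exactly one edge with it, so the sum over
    neighbours regroups by edges. *)
Lemma adjop_ph X (u : ph) :
  adjop X u = \sum_(e | u \in ph_edge e) (\sum_(v in ph_edge e) X v - X u).
Proof.
rewrite /adjop.
under [RHS]eq_bigr => e ue.
  rewrite (bigD1 u ue) /= [X u + _]addrC addrK.
  over.
rewrite (exchange_big_dep (fun v => hadj u v)) /=; last first.
  move=> e v ue /andP[ve vu]; rewrite hadj_ph eq_sym vu /=.
  by apply/existsP; exists e; rewrite ue.
rewrite [LHS](bigID (fun v => hadj u v)) /= [X in _ + X]big1 ?addr0; last first.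
  by move=> v /negPf ->; rewrite mul0r.
apply: eq_bigr => v uv; rewrite uv mul1r.
move: uv; rewrite hadj_ph => /andP[uv /existsP[e /andP[ue ve]]].
rewrite (big_pred1 e) // => e' /=.
apply/andP/eqP => [[ue' /andP[ve' _]]|->]; last first.
  by split => //; apply/andP; split => //; rewrite eq_sym.
exact: (ph_edge_meet uv ue' ve').
Qed.

Lemma quad_ph X : \sum_u X u * adjop X u =
  \sum_e ((\sum_(v in ph_edge e) X v) ^+ 2 - \sum_(v in ph_edge e) X v ^+ 2).
Proof.
under eq_bigr do rewrite adjop_ph mulr_sumr.
rewrite (exchange_big_dep predT) //=; apply: eq_bigr => e _.
under eq_bigr do rewrite mulrBr.
by rewrite sumrB -mulr_suml.
Qed.
End PowerOfEnds.

(** * Moving edges to a vertex of maximal weight *)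

Section Transfer.
Variables (R : realType) (m : nat) (V E : finType) (ends ends' : E -> {set V}).
Hypotheses (m_ge2 : (2 <= m)%N) (sG : simple_ends ends) (sG' : simple_ends ends').
Hypothesis cG' : connected_hg (ph m ends').
Variables (X : ph_vert m V E -> R) (w : V).
Hypothesis X_gt0 : forall u, 0 < X u.
Hypothesis XA : forall u, adjop (X : ph m ends -> R) u = mu R m (ph m ends) * X u.

Definition moved e := exists p, [/\ p \in ends e, w \notin ends e,
  ends' e = w |: (ends e :\ p) & X (inl p) <= X (inl w)].

Hypothesis move_ends : forall e, ends' e = ends e \/ moved e.

Let S (g : E -> {set V}) e := \sum_(v in ph_edge m g e) X v.

(** Strict because of the second endpoint; this is what makes a moved edge count strictly at [w]. *)
Let S_other e p : p \in ends e -> X (inl p) < S ends e.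
Proof.
move=> pe; rewrite /S ph_edge_sum (bigD1 p) //= -addrA ltrDl.
have [q /andP[qe qp]] : exists q, (q \in ends e) && (q != p).
  have /eqP/cards2P[a [b [ab E2]]] := sG.1 e.
  move: pe; rewrite E2 !inE => /orP[]/eqP->.
    by exists b; rewrite !inE eqxx orbT eq_sym ab.
  by exists a; rewrite !inE eqxx ab.
rewrite (bigD1 q) ?qe //= -addrA ltr_pwDl // addr_ge0 // sumr_ge0 // => *;
  exact: ltW.
Qed.

Let move_sum (Y : ph_vert m V E -> R) e p :
  p \in ends e -> w \notin ends e -> ends' e = w |: (ends e :\ p) ->
  \sum_(v in ph_edge m ends' e) Y v =
  \sum_(v in ph_edge m ends e) Y v - Y (inl p) + Y (inl w).
Proof.
move=> pe we E'; rewrite !ph_edge_sum E' big_setU1 ?inE ?(negPf we) ?andbF //=.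
rewrite (big_setD1 p pe) /=; ring.
Qed.

(** With $a$, $b$ the values at [p] and [w], the right side exceeds the left by $2(b-a)(s-a)$. *)
Let gap e : let q g := S g e ^+ 2 - \sum_(v in ph_edge m g e) X v ^+ 2 in
  q ends <= q ends'.
Proof.
rewrite /=; case: (move_ends e) => [E'|[p [pe we E' le_pw]]].
  by rewrite /S !ph_edge_sum E'.
rewrite {2}/S !(move_sum _ pe we E') -/(S ends e).
have := S_other pe; have := X_gt0 (inl p); move: (S ends e) (\sum_(_ in _) _).
move=> s t; nra.
Qed.

Let mono : mu R m (ph m ends) * \sum_u X u ^+ 2 <=
  \sum_u X u * adjop (X : ph m ends' -> R) u.
Proof.
rewrite mulr_sumr quad_ph //.
under eq_bigr do rewrite expr2 mulrCA -XA.
by rewrite quad_ph //; apply: ler_sum => e _; apply: gap.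
Qed.

Let sq_gt0 : 0 < \sum_u X u ^+ 2.
Proof.
by rewrite (bigD1 (inl w)) //= ltr_pwDl ?exprn_gt0 // sumr_ge0 // => *; exact: sqr_ge0.
Qed.

Let ph_gt0 (g : E -> {set V}) : (0 < #|ph m g|)%N.
Proof. by apply/card_gt0P; exists (inl w). Qed.

Lemma transfer_le : mu R m (ph m ends) <= mu R m (ph m ends').
Proof.
rewrite -(ler_pM2r sq_gt0); apply: le_trans mono _.
exact: (rayleigh m_ge2 (ph_gt0 ends') cG').
Qed.

(* If equality holds then [X] is an eigenvector for both hypergraphs, and the two
   eigenvalue equations at [w] differ by the contributions of the moved edges. *)
Lemma transfer_eq : mu R m (ph m ends) = mu R m (ph m ends') ->
  forall e, ends' e = ends e.
Proof.
move=> eq_mu.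
have XA' : forall u, adjop (X : ph m ends' -> R) u = mu R m (ph m ends') * X u.
  apply: (rayleigh_eq m_ge2 (ph_gt0 ends') cG'); apply/eqP; rewrite eq_le.
  by rewrite (rayleigh m_ge2 (ph_gt0 ends') cG') -eq_mu mono.
(* The contribution of [e] to the eigenvalue equation at [w]. A moved edge contributes 0 before the
   move and $s-a>0$ after it. *)
pose t g e := if inl w \in ph_edge m g e then S g e - X (inl w) else 0.
have sum_t : \sum_e (t ends e - t ends' e) = 0.
  have := XA' (inl w); rewrite -eq_mu -(XA (inl w)) (adjop_ph sG') (adjop_ph sG).
  by move=> h; rewrite sumrB /t -!big_mkcond /= /S h subrr.
pose T e := t ends e - t ends' e.
have le_T e : T e <= 0 /\ (T e = 0 -> ends' e = ends e).
  rewrite /T /t /S; case: (move_ends e) => [E'|[p [pe we E' le_pw]]].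
    have -> : ph_edge m ends' e = ph_edge m ends e by rewrite /ph_edge E'.
    by rewrite subrr; split; first exact: lexx.
  rewrite !mem_ph_edge (negPf we) E' setU11 (move_sum _ pe we E').
  have := S_other pe; rewrite /S; move: (\sum_(_ in _) _) => s lt_s.
  rewrite sub0r; move: (X (inl p)) (X (inl w)) le_pw lt_s => a b ab lt_s.
  have lt0 : - (s - a + b - b) < 0 by rewrite addrK oppr_lt0 subr_gt0.
  split; first exact: ltW.
  by move=> h; rewrite h ltxx in lt0.
move=> e; apply: (le_T e).2; apply/eqP; rewrite -oppr_eq0; apply/eqP.
have T0 e' : true -> 0 <= - T e' by rewrite oppr_ge0; case: (le_T e').
by move: e isT; apply: (psumr_eq0P T0); rewrite sumrN sum_t oppr0.
Qed.
End Transfer.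

(** * Isomorphism invariance *)

Lemma imset_can (T T' : finType) (f : T -> T') (g : T' -> T) (A : {set T}) :
  cancel f g -> g @: (f @: A) = A.
Proof. by move=> fK; rewrite -imset_comp (eq_imset _ fK) imset_id. Qed.

Lemma hiso_trans (H K L : hypergraph) : hiso H K -> hiso K L -> hiso H L.
Proof.
move=> [f bf fE] [g bg gE]; exists (g \o f); first exact: bij_comp.
move=> e.
by rewrite imset_comp -gE -fE.
Qed.

Lemma hiso_sym (H K : hypergraph) : hiso H K -> hiso K H.
Proof.
move=> [f [g fK gK] fE]; exists g; first by exists f.
move=> e.
by rewrite fE imset_can.
Qed.

Section IsoTransport.
Variables (H K : hypergraph).

Lemma hiso_hadj (f : H -> K) : injective f ->
  (forall e : {set H}, (e \in hedge H) = (f @: e \in hedge K)) -> bijective f ->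
  forall u v, hadj (f u) (f v) = hadj u v.
Proof.
move=> fI fE [g fK gK] u v; rewrite /hadj (inj_eq fI); congr (_ && _).
apply/existsP/existsP => -[e /and3P[eE ue ve]]; last first.
  by exists (f @: e); rewrite -fE eE !imset_f.
by exists (g @: e); rewrite fE imset_can // eE -[u]fK -[v]fK !imset_f.
Qed.

Lemma adjop_iso (R : realType) (f : H -> K) (X : K -> R) : bijective f ->
  (forall e : {set H}, (e \in hedge H) = (f @: e \in hedge K)) ->
  forall u, adjop (X \o f) u = adjop X (f u).
Proof.
move=> bf fE u; have [g fK gK] := bf.
rewrite /adjop [RHS](reindex f) /=; last by exists g => x _.
by apply: eq_bigr => v _; rewrite (hiso_hadj (bij_inj bf) fE bf).
Qed.

Hypothesis isoHK : hiso H K.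

Lemma hiso_connected : connected_hg H -> connected_hg K.
Proof.
case: isoHK => f bf fE Hc; have adj := hiso_hadj (bij_inj bf) fE bf.
have [g fK gK] := bf; move=> u v; rewrite -[u]gK -[v]gK.
have /connectP[p pp ->] := Hc (g u) (g v).
elim: p (g u) pp => [|y p IH] x /=; first by rewrite connect0.
move=> /andP[xy /IH]; apply: connect_trans; apply: connect1.
by rewrite adj.
Qed.

Lemma hiso_linear : linear_hg H -> linear_hg K.
Proof.
case: (hiso_sym isoHK) => g bg gE Hl e f eK fK ef.
have gI := bij_inj bg.
rewrite -(card_imset _ gI) imsetI; last by move=> ? ? _ _; apply: gI.
by apply: Hl; rewrite -?gE // (inj_eq (imset_inj gI)).
Qed.

Lemma hiso_uniform m : uniform m H -> uniform m K.
Proof.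
case: (hiso_sym isoHK) => g bg gE Hu e eK.
by rewrite -(card_imset _ (bij_inj bg)); apply: Hu; rewrite -gE.
Qed.

Lemma hiso_hedge (f : H -> K) : bijective f ->
  (forall e : {set H}, (e \in hedge H) = (f @: e \in hedge K)) ->
  hedge K = [set f @: (e : {set H}) | e : {set H} in hedge H].
Proof.
move=> [g fK gK] fE; apply/setP => e; apply/idP/imsetP => [eK|[e' e'H ->]].
  by exists (g @: e); rewrite ?fE imset_can.
by rewrite -fE.
Qed.

Lemma hiso_card_hedge : #|hedge K| = #|hedge H|.
Proof.
case: isoHK => f bf fE; rewrite (hiso_hedge bf fE) card_imset //.
exact/imset_inj/bij_inj.
Qed.

Lemma loose_cycle_iso (f : H -> K) : bijective f ->
  (forall e : {set H}, (e \in hedge H) = (f @: e \in hedge K)) ->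
  forall l (S : {set {set H}}), loose_cycle_in l S ->
  loose_cycle_in l [set f @: (e : {set H}) | e : {set H} in S].
Proof.
move=> bf fE l S [l3 SH [v [e [vI eI SE ev ed]]]]; have fI := bij_inj bf.
have fII A B : f @: (A :&: B) = f @: A :&: f @: B.
  by apply: imsetI => ? ? _ _; apply: fI.
split=> //.
  rewrite {1}SE; apply/subsetP => _ /imsetP[_ /imsetP[i _ ->] ->]; rewrite -fE.
  by apply: (subsetP SH); rewrite SE imset_f.
exists (f \o v), (fun i => f @: (e i : {set H})); split.
- exact: inj_comp.
- by move=> i j /(imset_inj fI)/eI.
- by rewrite SE -imset_comp.
- by move=> i; rewrite -fII ev imset_set1.
- by move=> i j *; rewrite -setI_eq0 -fII imset_eq0 setI_eq0 ed.
Qed.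
End IsoTransport.

Lemma hiso_unicyclic (H K : hypergraph) : hiso H K -> unicyclic H -> unicyclic K.
Proof.
move=> iso [S [[l lS] uS]]; have [f bf fE] := iso.
have [g bg gE] := hiso_sym iso.
exists [set f @: (e : {set H}) | e : {set H} in S]; split.
  by exists l; apply: loose_cycle_iso.
move=> S' [l' lS']; apply: (imset_inj (imset_inj (bij_inj bg))).
have <- := uS _ (ex_intro _ l' (loose_cycle_iso bg gE lS')).
by apply/esym/uS; exists l; apply: (loose_cycle_iso bg gE); apply: loose_cycle_iso.
Qed.

Lemma hiso_in_UC m l k (H K : hypergraph) :
  hiso H K -> in_UC m l k H -> in_UC m l k K.
Proof.
move=> iso [Hc Hl Hu [Hun [G [G2 isoG]] Hk [S lS]]]; split.
- exact: hiso_connected Hc.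
- exact: hiso_linear Hl.
- exact: hiso_uniform Hu.
split; first exact: hiso_unicyclic Hun.
- by exists G; split=> //; apply: hiso_trans isoG; apply: hiso_sym.
- by rewrite (hiso_card_hedge iso).
- by have [f bf fE] := iso; eexists; apply: (loose_cycle_iso bf fE lS).
Qed.

(** Instead of conjugating [adjmx] by a permutation, a Perron vector is pulled back; by [mu_unique]
    a positive eigenvector determines the radius. *)
Lemma hiso_lambda1 (R : realType) m (H K : hypergraph) : (2 <= m)%N ->
  (0 < #|H|)%N -> connected_hg H -> hiso H K -> lambda1 R m H = lambda1 R m K.
Proof.
move=> m2 H0 Hc iso; have Kc := hiso_connected iso Hc.
have [f bf fE] := iso; have [g fK gK] := bf.
have K0 : (0 < #|K|)%N.
  by have /card_gt0P[x _] := H0; apply/card_gt0P; exists (f x).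
have [w [w0 wA]] := perron R m2 K0 Kc.
suff : mu R m K = mu R m H.
  by move=> /mulfI ->//; rewrite subr_eq0 pnatr_eq1 gtn_eqF.
apply: (mu_unique m2 H0 Hc (X := w \o f)) => [u|u]; first exact: w0.
by rewrite adjop_iso // wA.
Qed.

Section PowerMap.
Variables (m : nat) (V V' E E' : finType).
Variables (ends : E -> {set V}) (ends' : E' -> {set V'}).
Variables (phi : V -> V') (psi : E -> E').
Hypotheses (phi_bij : bijective phi) (psi_bij : bijective psi).
Hypothesis endsE : forall e, ends' (psi e) = phi @: ends e.

Definition ph_map (u : ph m ends) : ph m ends' :=
  match u with inl v => inl (phi v) | inr p => inr (psi p.1, p.2) end.

Lemma ph_map_bij : bijective ph_map.
Proof.
have [phi' phiK phiK'] := phi_bij; have [psi' psiK psiK'] := psi_bij.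
exists (fun u : ph m ends' => match u with inl v => inl (phi' v)
  | inr p => inr (psi' p.1, p.2) end : ph m ends) => [[v|[e j]]|[v|[e j]]] /=;
by rewrite ?phiK ?psiK ?phiK' ?psiK'.
Qed.

Lemma ph_map_hedge (A : {set ph m ends}) :
  (A \in hedge (ph m ends)) = (ph_map @: A \in hedge (ph m ends')).
Proof.
have fI := bij_inj ph_map_bij; have [g fK gK] := ph_map_bij.
have fe e : ph_map @: ph_edge m ends e = ph_edge m ends' (psi e).
  apply/setP => u; rewrite -[u]gK mem_imset //.
  case: {u}(g u) => [v|[e' j]]; rewrite !mem_ph_edge ?(inj_eq (bij_inj psi_bij)) //.
  by rewrite endsE mem_imset //; apply: bij_inj.
rewrite !inE imset_eq0; congr (_ && _).
apply/imsetP/imsetP => [[e _ ->]|[e _ Ae]]; first by exists (psi e).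
have [psi' psiK psiK'] := psi_bij.
by exists (psi' e) => //; apply: (imset_inj fI); rewrite fe psiK' -Ae.
Qed.

Lemma ph_hiso : hiso (ph m ends) (ph m ends').
Proof. by exists ph_map; [exact: ph_map_bij | exact: ph_map_hedge]. Qed.
End PowerMap.

Section PowersOfGraphs.
Variables (m : nat) (G : hypergraph).
Hypothesis G2 : uniform 2 G.

Definition graph_ends (e : {e : {set G} | e \in hedge G}) : {set G} := val e.

Lemma graph_ends_simple : simple_ends graph_ends.
Proof. by split=> [e|]; [apply/G2/valP | apply: val_inj]. Qed.

Lemma power_hg_ph : hiso (power_hg m G) (ph m graph_ends).
Proof.
(* The two vertex types are convertible, so the identity serves as isomorphism. *)
exists (fun x => x); first by exists (fun x => x).
move=> A.
have mem := @mem_hedge_ph m _ _ _ graph_ends_simple A.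
rewrite imset_id; apply/idP/idP.
  by move=> /imsetP[e _ Ae]; apply/mem; exists e.
by move/mem => [e ->]; apply/imsetP; exists e.
Qed.
End PowersOfGraphs.

Lemma ph_in_powers m (V E : finType) (ends : E -> {set V}) :
  simple_ends ends -> in_powers m (ph m ends).
Proof.
move=> sG; have nz : set0 \notin [set ends e | e : E] :\ set0 by rewrite !inE eqxx.
have inG e : ends e \in [set ends e | e : E] :\ set0.
  by rewrite !inE imset_f // andbT -card_gt0 sG.1.
have G2 : uniform 2 (Hypergraph nz).
  by move=> A; rewrite !inE => /andP[_ /imsetP[e _ ->]]; rewrite sG.1.
exists (Hypergraph nz); split=> //.
apply: hiso_trans (hiso_sym (power_hg_ph m G2)).
pose psi e : {A : {set V} | A \in hedge (Hypergraph nz)} := exist _ (ends e) (inG e).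
apply: (@ph_hiso m _ _ _ _ _ _ id psi); first by exists id.
  apply: inj_card_bij => [e e' []|]; first exact: sG.2.
  rewrite card_sig -(card_imset predT sG.2); apply: subset_leq_card.
  by apply/subsetP => A; rewrite !inE => /andP[_ /imsetP[e _ ->]]; rewrite imset_f.
by move=> e; rewrite imset_id.
Qed.

(** * Loose cycles of power hypergraphs *)

Lemma val_ordS l (i : 'I_l) :
  nat_of_ord (ordS i) = if i.+1 == l then 0 else i.+1.
Proof.
rewrite /=; case: eqP => [->|il]; first exact: modnn.
by rewrite modn_small // ltn_neqAle ltn_ord andbT; apply/eqP.
Qed.

Section OrdS.
Variable l : nat.
Hypothesis l3 : (3 <= l)%N.

Lemma ordS_neq (i : 'I_l) : ordS i != i.
Proof.
by apply/eqP => /(congr1 (@nat_of_ord l)); rewrite val_ordS; case: eqP => ? ?; lia.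
Qed.

Lemma ordSS_neq (i : 'I_l) : ordS (ordS i) != i.
Proof.
apply/eqP => /(congr1 (@nat_of_ord l)); rewrite !val_ordS.
by have := ltn_ord i; case: (i.+1 =P l) => h h'; case: eqP => ? ?; lia.
Qed.
End OrdS.

(** Distinctness of the edges is not demanded: for $l\ge3$ it follows from that of the vertices, see
    [gcycle_inj]. *)
Definition gcycle (V E : finType) (ends : E -> {set V}) (l : nat)
    (v : 'I_l -> V) (e : 'I_l -> E) :=
  injective v /\ forall i, ends (e i) = [set v i; v (ordS i)].

Section GraphCycles.
Variables (m : nat) (V E : finType) (ends : E -> {set V}).
Hypothesis sG : simple_ends ends.

Lemma ends_eq e a b : a != b -> a \in ends e -> b \in ends e ->
  ends e = [set a; b].
Proof.
move=> ab ae be; apply/esym/eqP.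
by rewrite eqEcard cards2 ab sG.1 leqnn andbT subUset !sub1set ae.
Qed.

(** If two different positions gave the same pair, each would be the successor of the other, which
    [ordSS_neq] excludes for $l\ge3$. *)
Lemma edge_pair_inj (l : nat) (v : 'I_l -> V) : (3 <= l)%N -> injective v ->
  injective (fun i => [set v i; v (ordS i)]).
Proof.
move=> l3 vI i j /setP eq_ij.
have := eq_ij (v i); rewrite !inE eqxx /= !(inj_eq vI) => /esym/orP[/eqP//|/eqP ij].
have := eq_ij (v j); rewrite !inE eqxx /= !(inj_eq vI) => /orP[/eqP//|/eqP ji].
by have := ordSS_neq l3 j; rewrite -ij -ji eqxx.
Qed.

Lemma gcycle_inj l (v : 'I_l -> V) (e : 'I_l -> E) :
  (3 <= l)%N -> gcycle ends v e -> injective e.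
Proof.
move=> l3 [vI ve] i j /(congr1 ends); rewrite !ve; exact: edge_pair_inj.
Qed.

(** A core vertex lies in two distinct edges and an added vertex in only one, so all core vertices
    are graph vertices. *)
Lemma gcycle_of_loose l (S : {set {set ph m ends}}) : loose_cycle_in l S ->
  (3 <= l)%N /\ exists v e, gcycle ends (l := l) v e /\
    S = [set ph_edge m ends (e i) | i : 'I_l].
Proof.
move=> [l3 SH [v [e [vI eI SE ev ed]]]]; split=> //.
have /fin_all_exists[c ec] i : exists f, e i = ph_edge m ends f.
  by apply/(mem_hedge_ph sG)/(subsetP SH); rewrite SE imset_f.
have cI : injective c by move=> i j ij; apply: eI; rewrite !ec ij.
have vin i : v i \in ph_edge m ends (c (ord_pred i)) /\ v i \in ph_edge m ends (c i).
  by apply/andP; rewrite -!ec -in_setI ev inE.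
have /fin_all_exists[x vx] i : exists y, v i = inl y.
  case: (v i) (vin i) => [y _|[f j]]; first by exists y.
  rewrite !mem_ph_edge => -[/eqP-> /eqP/cI ii].
  by have := ordS_neq l3 i; rewrite -[i in ordS i]ii ord_predK eqxx.
have xI : injective x by move=> i j ij; apply: vI; rewrite !vx ij.
exists x, c; split; last first.
  by rewrite SE; apply: eq_imset.
split=> // i; apply: ends_eq; first by rewrite (inj_eq xI) eq_sym ordS_neq.
  by have [_] := vin i; rewrite vx mem_ph_edge.
by have [] := vin (ordS i); rewrite ordSK vx mem_ph_edge.
Qed.

Lemma loose_of_gcycle l (v : 'I_l -> V) (e : 'I_l -> E) : (3 <= l)%N ->
  gcycle ends v e ->
  loose_cycle_in (H := ph m ends) l [set ph_edge m ends (e i) | i : 'I_l].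
Proof.
move=> l3 ve; have eI := gcycle_inj l3 ve; have [vI eE] := ve.
split=> //.
  by apply/subsetP => _ /imsetP[i _ ->]; apply/(mem_hedge_ph sG); exists (e i).
exists (fun i => inl (v i)), (fun i => ph_edge m ends (e i)); split=> //.
- by move=> i j []/vI.
- by move=> i j /(ph_edge_inj sG)/eI.
- move=> i; apply/setP => -[y|[f j]]; rewrite in_setI in_set1 !mem_ph_edge.
    have inlI : injective (@inl V (E * 'I_(m - 2))) by move=> ? ? [].
    rewrite !eE !inE ord_predK (inj_eq inlI).
    have [->|yi] := eqVneq y (v i); first by rewrite orbT.
    rewrite orbF /=; apply/negP => /andP[/eqP -> /eqP/vI].
    by move/(congr1 (@ordS l))/eqP; rewrite ord_predK eq_sym (negPf (ordSS_neq l3 i)).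
  apply/andP => -[/eqP-> /eqP/eI ii].
  by have := ordS_neq l3 i; rewrite -[i in ordS i]ii ord_predK eqxx.
- move=> i j ji jSi iSj; rewrite -setI_eq0; apply/eqP/setP.
  move=> -[y|[f t]]; rewrite in_setI in_set0 !mem_ph_edge; last first.
    by apply/andP => -[/eqP-> /eqP/eI ij]; rewrite ij eqxx in ji.
  rewrite !eE !inE; apply/andP => -[/orP[]/eqP->]; rewrite !(inj_eq vI).
    by rewrite eq_sym (negPf ji) (negPf iSj).
  rewrite eq_sym (negPf jSi) /= (inj_eq (can_inj (@ordSK _))) eq_sym.
  by rewrite (negPf ji).
Qed.

(** The form used for counting: a subgraph that misses one edge of a cycle contains no cycle at
    all. *)
Lemma ph_unicyclicP : unicyclic (ph m ends) ->
  forall l l' (v : 'I_l -> V) (e : 'I_l -> E) (v' : 'I_l' -> V) (e' : 'I_l' -> E),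
  (3 <= l)%N -> (3 <= l')%N -> gcycle ends v e -> gcycle ends v' e' ->
  forall i, exists j, e i = e' j.
Proof.
move=> [S [_ uS]] l l' v e v' e' l3 l3' ve ve' i.
have eS := uS _ (ex_intro _ l (loose_of_gcycle l3 ve)).
have eS' := uS _ (ex_intro _ l' (loose_of_gcycle l3' ve')).
have : ph_edge m ends (e i) \in [set ph_edge m ends (e' j) | j : 'I_l'].
  by rewrite -eS' eS; apply/imsetP; exists i.
by case/imsetP => j _ /(ph_edge_inj sG) ->; exists j.
Qed.

Lemma hadj_ph_inl (u v : V) : hadj (inl u : ph m ends) (inl v) =
  [exists e, ends e == [set u; v]].
Proof.
rewrite hadj_ph //; apply/andP/existsP => [[uv /existsP[e]]|[e /eqP eE]].
  rewrite !mem_ph_edge => /andP[ue ve]; exists e; apply/eqP/ends_eq => //.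
split; last by apply/existsP; exists e; rewrite !mem_ph_edge eE !inE !eqxx orbT.
by apply/eqP => -[uv]; have := sG.1 e; rewrite eE uv setUid cards1.
Qed.

Definition gadj (F : {set E}) : rel V :=
  fun u v => [exists e in F, ends e == [set u; v]].

Lemma gadj_sym F : symmetric (gadj F).
Proof. by move=> u v; rewrite /gadj setUC. Qed.

Lemma gconnect_sym F : connect_sym (gadj F).
Proof. exact/sym_connect_sym/gadj_sym. Qed.

(* Inner vertices of the path are replaced by an endpoint of their edge. *)
Lemma ph_connected_graph : connected_hg (ph m ends) ->
  forall u v, connect (gadj setT) u v.
Proof.
move=> Hc u v.
have key (x : ph m ends) (a : V) : connect (@hadj (ph m ends)) x (inl v) ->
    (forall b, x = inl b -> a = b) ->
    (forall e j, x = inr (e, j) -> a \in ends e) -> connect (gadj setT) a v.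
  move=> /connectP[p]; elim: p x a => [|y p IH] x a /= => [_ <- /(_ v erefl) -> _|].
    exact: connect0.
  move=> /andP[xy pp] yv ax1 ax2.
  have step b e : a \in ends e -> b \in ends e -> connect (gadj setT) a b.
    have [->|ab] := eqVneq a b; first by rewrite connect0.
    move=> ae be; apply: connect1; apply/existsP; exists e.
    by rewrite inE (ends_eq ab) ?eqxx.
  move: xy; rewrite hadj_ph // => /andP[_ /existsP[e /andP[xe ye]]].
  have ae : a \in ends e.
    case: x xe ax1 ax2 => [b|[f j]] + ax1 ax2; rewrite mem_ph_edge.
      by rewrite (ax1 b).
    by move=> /eqP <-; apply: ax2.
  case: y pp yv ye => [b|[f j]] pp yv; rewrite mem_ph_edge => ye.
    apply: (connect_trans (step b e ae ye)); apply: IH pp yv _ _ => //.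
    by move=> ? [].
  apply: IH pp yv _ _ => // e' j' [<- _]; by rewrite (eqP ye).
by apply: (key (inl u)) => // b [].
Qed.

Lemma graph_ph_connected (v0 : V) : (forall u v, connect (gadj setT) u v) ->
  connected_hg (ph m ends).
Proof.
move=> Gc.
have inl_c (u v : V) : connect (@hadj (ph m ends)) (inl u) (inl v).
  have /connectP[p pp ->] := Gc u v.
  elim: p u pp => [|y p IH] u /=; first by rewrite connect0.
  move=> /andP[uy /IH]; apply: connect_trans; apply: connect1.
  rewrite hadj_ph_inl; move: uy => /existsP[e /andP[_ ?]].
  by apply/existsP; exists e.
have csym : connect_sym (@hadj (ph m ends)).
  by apply: sym_connect_sym => a b; apply: hadj_sym.
have to_v0 (x : ph m ends) : connect (@hadj (ph m ends)) x (inl v0).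
  case: x => [u|[e j]]; first exact: inl_c.
  have /card_gt0P[u ue] : (0 < #|ends e|)%N by rewrite sG.1.
  apply: connect_trans (inl_c u v0); apply: connect1; rewrite hadj_ph //=.
  by apply/existsP; exists e; rewrite !mem_ph_edge eqxx.
move=> x y; apply: (connect_trans (to_v0 x)); rewrite csym; exact: to_v0.
Qed.
End GraphCycles.

(** * Trees and cycles in graphs *)

Section Trees.
Variables (V E : finType) (ends : E -> {set V}).
Hypothesis sG : simple_ends ends.

(** [par q] is the first edge of a shortest walk from [q] to [D], and [rk] is the distance to [D].
    These edges form a forest rooted at [D]; [e0] is a dummy value for the roots. *)
Lemma parent_edges (F : {set E}) (D : {set V}) (e0 : E) :
  (forall q, exists2 d, d \in D & connect (gadj ends F) q d) ->
  exists par : V -> E, [/\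
    forall q, q \notin D -> par q \in F,
    forall q, q \notin D -> exists p, ends (par q) = [set q; p],
    {in ~: D &, injective par} &
    forall q, exists2 d, d \in D & connect (gadj ends (par @: ~: D)) q d].
Proof.
move=> toD.
pose P q n := [exists p : n.-tuple V, path (gadj ends F) q p && (last q p \in D)].
have /fin_all_exists[rk rkP] q : exists n, P q n /\ forall n', P q n' -> (n <= n')%N.
  have [n Pn min_n] : exists2 n, P q n & forall n', P q n' -> (n <= n')%N.
    have ex : exists n, P q n.
      have [d dD /connectP[p pp dE]] := toD q; exists (size p).
      by apply/existsP; exists (in_tuple p); rewrite pp -dE.
    by exists (ex_minn ex); case: ex_minnP.
  by exists n.
have step q : q \notin D ->
    exists ep : E * V, [/\ ep.1 \in F, ends ep.1 = [set q; ep.2] & (rk ep.2 < rk q)%N].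
  move=> qD; have [+ _] := rkP q.
  case: (rk q) => [|n]; first by move=> /existsP[p]; rewrite tuple0 /= (negPf qD).
  move=> /existsP[p]; case/tupleP: p => y p /= /andP[/andP[qy pp] lD].
  have /existsP[e /andP[eF /eqP eE]] := qy.
  exists (e, y); split=> //=; rewrite ltnS; apply: (rkP y).2.
  by apply/existsP; exists p; rewrite pp.
have /fin_all_exists[ep epP] q : exists ep : E * V, q \notin D ->
    [/\ ep.1 \in F, ends ep.1 = [set q; ep.2] & (rk ep.2 < rk q)%N].
  have [qD|/step[ep ?]] := boolP (q \in D); first by exists (e0, q).
  by exists ep.
exists (fun q => (ep q).1); split.
- by move=> q /epP[].
- by move=> q /epP[_ ? _]; exists (ep q).2.
(* If distinct vertices shared a parent edge, each would be the parent of the other and strictly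
   nearer to [D]. *)
- move=> q q'; rewrite !inE => /epP[_ qE q_lt] /epP[_ q'E q'_lt] eq_e.
  rewrite -eq_e {}qE in q'E; have /setP := q'E => {}q'E.
  have := q'E q; rewrite !inE eqxx /= => /esym/orP[/eqP//|/eqP q2].
  have := q'E q'; rewrite !inE eqxx /= => /orP[/eqP//|/eqP q'2].
  by rewrite -q2 -q'2 in q_lt q'_lt; lia.
- move=> q; have [n] := ubnP (rk q); elim: n q => // n IH q rk_q.
  have [qD|qD] := boolP (q \in D); first by exists q.
  have [_ qE q_lt] := epP _ qD; have [|d dD dc] := IH (ep q).2; first by lia.
  exists d => //; apply: connect_trans dc; apply: connect1; apply/existsP.
  by exists (ep q).1; rewrite qE eqxx andbT; apply: imset_f; rewrite inE.
Qed.

(** A simple path from [a] to [b] avoiding [e0] is closed up by [e0], which joins the last index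
    back to the first. *)
Lemma cycle_of_nonbridge (F : {set E}) e0 a b :
  e0 \in F -> ends e0 = [set a; b] -> connect (gadj ends (F :\ e0)) a b ->
  exists l (v : 'I_l -> V) (e : 'I_l -> E),
    [/\ (3 <= l)%N, gcycle ends v e & forall i, e i \in F].
Proof.
move=> e0F e0E /connectP[p0 pp0 bE0].
have ab : a != b.
  by apply/eqP => ab; have := sG.1 e0; rewrite e0E ab setUid cards1.
case/shortenP: pp0 bE0 => p pp up _ bE.
pose v (i : 'I_(size p).+1) := nth a (a :: p) i.
have /fin_all_exists[e eP] i : exists f, f \in F /\ ends f = [set v i; v (ordS i)].
  rewrite /v val_ordS; case: eqP => [[iE]|iN].
    by exists e0; rewrite iE e0E bE (last_nth a) setUC.
  have ip : (i < size p)%N by have := ltn_ord i; lia.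
  have /pathP-/(_ a _ ip)/existsP[f /andP[+ /eqP fE]] := pp.
  by rewrite !inE => /andP[_ fF]; exists f.
(* A path with a single edge would be parallel to [e0]. *)
have l3 : (3 <= (size p).+1)%N.
  case: p pp bE {up v e eP} => [|y [|z p]] //= => [_ ba|]; first by rewrite ba eqxx in ab.
  move=> /andP[/existsP[f /andP[]]]; rewrite !inE => /andP[fe0 _] /eqP fE _ yb.
  by rewrite -yb -e0E in fE; rewrite (sG.2 _ _ fE) eqxx in fe0.
exists (size p).+1, v, e; split=> // [|i]; last by case: (eP i).
split=> [i j /eqP|i]; last by case: (eP i).
by rewrite /v nth_uniq ?ltn_ord // => /eqP/val_inj.
Qed.

(** The parent edges towards one root number $|V|-1$ and already connect everything, so [F] has an
    edge outside them, and that edge is no bridge. *)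
Lemma cycle_of_many_edges (F : {set E}) :
  (forall u v, connect (gadj ends F) u v) -> (0 < #|V|)%N -> (#|V| <= #|F|)%N ->
  exists l (v : 'I_l -> V) (e : 'I_l -> E),
    [/\ (3 <= l)%N, gcycle ends v e & forall i, e i \in F].
Proof.
move=> Fc V0 VF; have /card_gt0P[r _] := V0.
have /card_gt0P[f0 _] : (0 < #|F|)%N by apply: leq_trans VF.
have [|par [parF _ parI parc]] := @parent_edges F [set r] f0.
  by move=> q; exists r; rewrite ?inE.
have /subsetPn[e0 e0F e0par] : ~~ (F \subset par @: ~: [set r]).
  apply/negP => /subset_leq_card; rewrite card_in_imset // cardsC1.
  by move: VF V0; lia.
have /cards2P[a [b [_ e0E]]] : #|ends e0| == 2 by rewrite sG.1.
apply: (cycle_of_nonbridge e0F e0E).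
have sub u v : connect (gadj ends (par @: ~: [set r])) u v ->
    connect (gadj ends (F :\ e0)) u v.
  apply: connect_sub => {u v} u v /existsP[f /andP[fp fE]]; apply: connect1.
  apply/existsP; exists f; rewrite fE andbT !inE.
  rewrite (contraTneq _ fp) ?(contraNneq _ e0par) //; last by move=> ->.
  by case/imsetP: fp => q; rewrite !inE => qr ->; apply: parF; rewrite inE.
have [x /set1P-> /sub ax] := parc a; have [y /set1P-> /sub by_] := parc b.
by apply: (connect_trans ax); rewrite gconnect_sym.
Qed.
End Trees.

(** * Structure of unicyclic graphs *)

(* The graph of [UC_l(c_1 = c)], with [l = n + 1]: a cycle on the [inl i], and
   pendant vertices [inr j] attached at [inl 0]. *)
Definition uends (n c : nat) (e : 'I_n.+1 + 'I_c) : {set 'I_n.+1 + 'I_c} :=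
  match e with
  | inl i => [set inl i; inl (ordS i)]
  | inr j => [set inl ord0; inr j]
  end.

Lemma ordS_add n (i j : 'I_n.+1) : ordS (i + j) = ordS i + j.
Proof. by apply: val_inj; rewrite /= modnDml -addn1 modnDml addn1 addSn. Qed.

Lemma gcycle_rot (V E : finType) (ends : E -> {set V}) n
    (v : 'I_n.+1 -> V) (e : 'I_n.+1 -> E) (j : 'I_n.+1) :
  gcycle ends v e -> gcycle ends (fun i => v (i + j)) (fun i => e (i + j)).
Proof.
move=> [vI vE]; split=> [i i' /vI/addIr //|i].
by rewrite vE ordS_add.
Qed.

Section UnicyclicStructure.
Variables (V E : finType) (ends : E -> {set V}) (n : nat).
Variables (v : 'I_n.+3 -> V) (e : 'I_n.+3 -> E).
Hypothesis sG : simple_ends ends.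
Hypothesis Gc : forall x y, connect (gadj ends setT) x y.
Hypothesis ve : gcycle ends v e.
Hypothesis uni : forall l (v' : 'I_l -> V) (e' : 'I_l -> E), (3 <= l)%N ->
  gcycle ends v' e' -> forall i, exists j, e i = e' j.

Let eI : injective e. Proof. exact: gcycle_inj ve. Qed.
Let vI : injective v. Proof. by case: ve. Qed.
Let eE i : ends (e i) = [set v i; v (ordS i)]. Proof. by case: ve. Qed.

Lemma connect_without_last x y :
  connect (gadj ends (setT :\ e ord_max)) x y.
Proof.
have around i : connect (gadj ends (setT :\ e ord_max)) (v ord0) (v i).
  case: i => i; elim: i => [|i IH] i_lt.
    by rewrite (_ : Ordinal i_lt = ord0) ?connect0 //; apply: val_inj.
  apply: connect_trans (IH (ltnW i_lt)) _; apply: connect1; apply/existsP.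
  exists (e (Ordinal (ltnW i_lt))); rewrite !inE (inj_eq eI) andbT eE.
  apply/andP; split; first by apply/eqP => /(congr1 val) /=; lia.
  rewrite (_ : ordS _ = Ordinal i_lt) //; apply: val_inj.
  by rewrite /= modn_small.
have sym := gconnect_sym ends (setT :\ e ord_max).
apply: connect_sub (Gc x y) => {x y} x y /existsP[f /andP[_ fE]].
have [f_last|f_last] := eqVneq f (e ord_max); last first.
  by apply: connect1; apply/existsP; exists f; rewrite !inE f_last.
have cyc i j : connect (gadj ends (setT :\ e ord_max)) (v i) (v j).
  by apply: (connect_trans _ (around j)); rewrite sym.
move: fE; rewrite f_last eE => /eqP/setP xy.
have := xy x; have := xy y; rewrite !inE !eqxx orbT /=.
by move=> /orP[]/eqP-> /orP[]/eqP->.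
Qed.

(** Otherwise, after deletion of one cycle edge, the graph is still connected with at least $|V|$
    edges, and so has a cycle avoiding that edge. *)
Lemma card_edges_le : (#|E| <= #|V|)%N.
Proof.
rewrite leqNgt; apply/negP => VE.
have V0 : (0 < #|V|)%N by apply/card_gt0P; exists (v ord0).
have VF : (#|V| <= #|setT :\ e ord_max|)%N.
  by move: VE; rewrite -[X in (_ < X)%N]cardsT (cardsD1 (e ord_max)) in_setT ltnS.
have [l [v' [e' [l3 ve' e'F]]]] := cycle_of_many_edges sG connect_without_last V0 VF.
have [j ej] := uni l3 ve' ord_max.
by have := e'F j; rewrite -ej !inE eqxx.
Qed.

Let T := ~: [set e i | i : 'I_n.+3].

(** A walk towards the cycle is followed up to its first cycle vertex; the edges before it have an
    endpoint off the cycle and so lie in [T]. *)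
Lemma connect_to_cycle q : exists i, connect (gadj ends T) q (v i).
Proof.
have /connectP[p pp vE] := Gc q (v ord0).
elim: p q pp vE => [|y p IH] q /=; first by move=> _ <-; exists ord0.
move=> /andP[/existsP[f /andP[_ fE]] pp] vE.
have [i yi] := IH y pp vE.
have [/codomP[j ->]|qN] := boolP (q \in codom v); first by exists j.
exists i; apply: connect_trans yi; apply: connect1; apply/existsP; exists f.
rewrite fE andbT !inE; apply: contra qN => /imsetP[j _ fj].
have : q \in ends f by rewrite (eqP fE) !inE eqxx.
by rewrite fj eE !inE => /orP[]/eqP->; exact: codom_f.
Qed.

(** The second clause covers [w] on the cycle: there the root must be [w] itself, so that replacing
    it by [w] changes nothing. *)
Lemma cycle_root w : exists i,
  connect (gadj ends T) w (v i) /\ forall j, w = v j -> j = i.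
Proof.
have [/codomP[i ->]|wN] := boolP (w \in codom v).
  by exists i; split=> [|j /vI //]; exact: connect0.
have [i wi] := connect_to_cycle w; exists i; split=> // j wj.
by rewrite wj codom_f in wN.
Qed.

(* Cycle edges keep their cycle order, rotated so that the cycle vertex
   hanging below [w] comes first; every other edge is indexed by its endpoint
   away from [w]. *)
Lemma unicyclic_structure c (w : V) : #|E| = (n.+3 + c)%N ->
  exists (phi : 'I_n.+3 + 'I_c -> V) (psi : 'I_n.+3 + 'I_c -> E),
  [/\ bijective phi, bijective psi, phi (inl ord0) = w &
   forall a, ends (psi a) = phi @: uends a \/
     exists p, [/\ p \in ends (psi a), w \notin ends (psi a) &
       phi @: uends a = w |: (ends (psi a) :\ p)]].
Proof.
move=> cardE; have [ic [wic wic_uniq]] := cycle_root w.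
(* The future cycle: [w] takes the place of [v ic]. If they differ, [v ic] becomes an ordinary tree
   vertex, reached from [w] through [T]. *)
pose D := w |: [set v i | i : 'I_n.+3 & i != ic].
have wD : w \notin [set v i | i : 'I_n.+3 & i != ic].
  by apply/imsetP => -[j]; rewrite inE => /eqP jN /wic_uniq.
have cardD : #|D| = n.+3.
  rewrite cardsU1 wD card_imset //.
  rewrite (_ : [set i | i != ic] = ~: [set ic]); last by apply/setP=> i; rewrite !inE.
  by rewrite cardsC1 card_ord.
have cardT : #|T| = c.
  by have := cardsC [set e i | i : 'I_n.+3]; rewrite card_imset // card_ord cardE -/T; lia.
have toD q : exists2 d, d \in D & connect (gadj ends T) q d.
  have [i qi] := connect_to_cycle q; have [iE|iN] := eqVneq i ic.
    exists w; first by rewrite !inE eqxx.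
    by apply: (connect_trans qi); rewrite iE gconnect_sym.
  by exists (v i) => //; rewrite inE imset_f ?orbT ?inE.
have [par [parT parE parI _]] := parent_edges (e ord0) toD.
(* At most [c] because parent edges are distinct elements of [T]; at least [c] by [card_edges_le].
   So parent edges exhaust [T]. *)
have cardCD : #|~: D| = c.
  apply/eqP; rewrite eqn_leq; apply/andP; split.
    rewrite -cardT -(card_in_imset parI); apply: subset_leq_card.
    by apply/subsetP => x /imsetP[q]; rewrite inE => /parT qT ->.
  by have := cardsC D; have := card_edges_le; rewrite cardD cardE; lia.
pose nv j : V := enum_val (cast_ord (esym cardCD) j).
have nvD j : nv j \notin D by have := enum_valP (cast_ord (esym cardCD) j); rewrite inE.
have nvI : injective nv by move=> i j /enum_val_inj/cast_ord_inj.
have [rI rE] := gcycle_rot ic ve.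
pose phi (a : 'I_n.+3 + 'I_c) :=
  match a with inl i => if i == ord0 then w else v (i + ic) | inr j => nv j end.
pose psi (a : 'I_n.+3 + 'I_c) :=
  match a with inl i => e (i + ic) | inr j => par (nv j) end.
have phiD i : phi (inl i) \in D.
  rewrite /phi; case: eqP => [_|iN]; first by rewrite !inE eqxx.
  rewrite inE imset_f ?orbT // inE -subr_eq0 addrK; exact/eqP.
have wv i : i != ord0 -> (w == v (i + ic)) = false.
  move=> iN; apply/eqP => /wic_uniq/eqP; rewrite -subr_eq0 addrK; exact/negP.
have phiI : injective phi.
  move=> [i|i] [j|j] ij.
  - congr inl; move: ij; rewrite /phi.
    case: (eqVneq i ord0) (@wv i) => [-> _|iN /(_ isT) wi];
    case: (eqVneq j ord0) (@wv j) => [-> _|jN /(_ isT) wj] //.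
    + by move=> /eqP; rewrite wj.
    + by move=> /esym/eqP; rewrite wi.
    + exact: rI.
  - by have := phiD i; rewrite ij (negPf (nvD j)).
  - by have := phiD j; rewrite -ij (negPf (nvD i)).
  - by rewrite (nvI _ _ ij).
have psiI : injective psi.
  have cyc i j : e (i + ic) != par (nv j).
    apply: contraTneq (parT _ (nvD j)) => <-; rewrite inE negbK imset_f //.
  move=> [i|i] [j|j] /= ij.
  - by move/eI/addIr: ij => ->.
  - by have := cyc i j; rewrite ij eqxx.
  - by have := cyc j i; rewrite ij eqxx.
  - by congr inr; apply/nvI/parI => //; rewrite inE nvD.
exists phi, psi; split.
- apply: inj_card_bij phiI _; rewrite card_sum !card_ord.
  by have := cardsC D; rewrite cardD cardCD => <-.
- by apply: inj_card_bij psiI _; rewrite card_sum !card_ord cardE.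
- by rewrite /phi eqxx.
(* The endpoint [q] is kept; the other one is [w] already or is moved there. *)
have move_pq a p q : ends a = [set p; q] -> q != w ->
    ends a = [set w; q] \/ exists p, [/\ p \in ends a, w \notin ends a &
      [set w; q] = w |: (ends a :\ p)].
  move=> aE qw; have [pw|pw] := eqVneq p w; first by left; rewrite aE pw.
  right; exists p; rewrite aE !inE eqxx ![w == _]eq_sym (negPf pw) (negPf qw).
  split=> //; congr (_ |: _); apply/setP => x; rewrite !inE.
  have [->|xq] := eqVneq x q; last by rewrite orbF andNb.
  rewrite orbT andbT; apply/esym/negP => /eqP qp.
  by have := sG.1 a; rewrite aE qp setUid cards1.
move=> [i|j]; rewrite /uends imsetU !imset_set1 /=; last first.
  have [p pE] := parE _ (nvD j); apply: move_pq.
    by rewrite pE setUC.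
  by apply: contraNneq (nvD j) => ->; rewrite !inE eqxx.
(* Among the cycle edges only the two at [v ic] are affected: the first keeps its end, the last
   keeps its start. *)
have [->|iN] := eqVneq i ord0.
  have S0 : ordS ord0 != ord0 :> 'I_n.+3 by exact: ordS_neq.
  rewrite (negPf S0); apply: move_pq; first by rewrite rE.
  by rewrite eq_sym wv.
have [Si|SiN] := eqVneq (ordS i) ord0; last by left; rewrite rE.
by rewrite setUC; apply: move_pq; rewrite ?rE 1?setUC // eq_sym wv.
Qed.
End UnicyclicStructure.

(** * The hypergraphs [UC_l(c_1 = c)] *)

(** The successor generates the cyclic group, so induction may start anywhere; [b] is reached from
    [a] in [b + (n.+1 - a)] steps. *)
Lemma ordS_ind n (P : 'I_n.+1 -> Prop) a :
  P a -> (forall i, P i -> P (ordS i)) -> forall b, P b.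
Proof.
move=> Pa PS b.
have Pk k : P (iter k (@ordS n.+1) a) by elim: k => //= k; apply: PS.
have iterE k : val (iter k (@ordS n.+1) a) = ((a + k) %% n.+1)%N.
  elim: k => [|k IH] /=; first by rewrite addn0 modn_small.
  by rewrite IH -addn1 modnDml addn1 addnS.
rewrite (_ : b = iter (b + (n.+1 - a)) (@ordS n.+1) a) //; apply: val_inj.
have a_lt := ltn_ord a; rewrite iterE addnCA subnKC; last exact: ltnW.
by rewrite modnDr modn_small.
Qed.

Section PowerShape.
Variables (m : nat) (V E : finType) (ends : E -> {set V}).
Hypotheses (m2 : (2 <= m)%N) (sG : simple_ends ends).

Lemma ph_linear : linear_hg (ph m ends).
Proof.
move=> _ _ /(mem_hedge_ph sG)[e ->] /(mem_hedge_ph sG)[f ->] ef.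
rewrite leqNgt; apply/negP => /card_gt1P[x [y [+ + xy]]].
rewrite !in_setI => /andP[xe xf] /andP[ye yf].
by move: ef; rewrite (ph_edge_meet sG xy xe ye xf yf) eqxx.
Qed.

Lemma ph_uniform : uniform m (ph m ends).
Proof.
move=> _ /(mem_hedge_ph sG)[e ->]; rewrite -sum1_card ph_edge_sum sum1_card.
rewrite sG.1 sum_nat_const card_ord muln1; exact: subnKC.
Qed.

Lemma card_hedge_ph : #|hedge (ph m ends)| = #|E|.
Proof.
rewrite -(card_imset predT (ph_edge_inj (m := m) sG)); apply: eq_card => A.
by apply/(mem_hedge_ph sG)/imsetP => [[e ->]|[e _ ->]]; exists e.
Qed.
End PowerShape.

Section CanonicalUnicyclic.
Variables n c : nat.
Notation I := ('I_n.+3 + 'I_c)%type.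
Implicit Type a : I.

Lemma uends_simple : simple_ends (@uends n.+2 c).
Proof.
split=> [[i|j]|[i|j] [i'|j']] /=.
- rewrite cards2 (_ : inl i != inl (ordS i)) //.
  by apply/eqP => -[/esym/eqP]; exact/negP/ordS_neq.
- by rewrite cards2.
- by move=> /(edge_pair_inj (v := @inl 'I_n.+3 'I_c)) -> // ? ? [].
- by move/setP/(_ (inr j')); rewrite !inE eqxx.
- by move/setP/(_ (inr j)); rewrite !inE eqxx.
- by move/setP/(_ (inr j)); rewrite !inE eqxx /= => /esym/eqP[->].
Qed.

Lemma uends_cycle : gcycle (@uends n.+2 c) inl inl.
Proof. by split=> // i j []. Qed.

Lemma uends_connected (a b : I) : connect (gadj (@uends n.+2 c) setT) a b.
Proof.
have sym := gconnect_sym (@uends n.+2 c) setT.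
have edge (e a' b' : I) : uends e = [set a'; b'] ->
    connect (gadj (@uends n.+2 c) setT) a' b'.
  by move=> eE; apply: connect1; apply/existsP; exists e; rewrite inE eE eqxx.
have to0 a' : connect (gadj (@uends n.+2 c) setT) (inl ord0) a'.
  case: a' => [i|j]; last exact: (edge (inr j)).
  apply: (@ordS_ind _ (fun i => connect _ (inl ord0) (inl i)) ord0); first exact: connect0.
  by move=> {}i /connect_trans; apply; apply: (edge (inl i)).
by apply: connect_trans (to0 b); rewrite sym.
Qed.

(** A pendant vertex lies in one edge only and a cycle vertex in two, so only edges [inl b] occur.
    The vertex [inl (ordS b)] of such an edge needs a second cycle edge, which must be
    [inl (ordS b)]; so the set of edges is closed under [ordS]. *)
Lemma uends_cycle_uniq l (v : 'I_l -> I) (e : 'I_l -> I) : (3 <= l)%N ->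
  gcycle (@uends n.+2 c) v e -> forall a, (a \in codom e) = (a \in codom (@inl 'I_n.+3 'I_c)).
Proof.
move=> l3 ve; have eI := gcycle_inj l3 ve; have [vI eE] := ve.
have vin i : v i \in uends (e i) by rewrite eE !inE eqxx.
have vin' i : v i \in uends (e (ord_pred i)) by rewrite eE !inE ord_predK eqxx orbT.
have predN (i : 'I_l) : ord_pred i != i.
  by apply/eqP => pi; have := ordS_neq l3 i; rewrite -{1}pi ord_predK eqxx.
have vN j i : v i != inr j.
  apply/eqP => vi; have := vin i; have := vin' i; rewrite vi.
  have only a : inr j \in uends a -> a = inr j.
    by case: a => [b|j'] /=; rewrite !inE //= => /eqP[->].
  move=> /only ei' /only ei; have := predN i.
  by rewrite -(inj_eq eI) ei ei' eqxx.
have eN j i : e i != inr j.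
  apply/eqP => ei; have := eE i; rewrite ei /= => /setP/(_ (inr j)).
  by rewrite !inE eqxx ![inr j == _]eq_sym !(negPf (vN j _)).
have e_inl i : exists b, e i = inl b.
  by case: (e i) (eN ^~ i) => [b _|j /(_ j)]; [exists b | rewrite eqxx].
have inlI : injective (@inl 'I_n.+3 'I_c) by move=> ? ? [].
have step b : inl b \in codom e -> inl (ordS b) \in codom e.
  case/codomP => i ib.
  have [x vx] : exists x, v x = inl (ordS b).
    have : inl (ordS b) \in uends (e i) by rewrite -ib !inE eqxx orbT.
    by rewrite eE !inE => /orP[]/eqP->; [exists i | exists (ordS i)].
  have pick y : inl (ordS b) \in uends (e y) -> e y = inl (ordS b) \/ e y = inl b.
    have [d ->] := e_inl y; rewrite !inE => /orP[/eqP/inlI->|/eqP/inlI]; first by left.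
    by move/(can_inj (@ordSK _)) ->; right.
  have := vin x; have := vin' x; rewrite vx => /pick[<- _|pb]; first exact: codom_f.
  move=> /pick[<-|xb]; first exact: codom_f.
  by have := predN x; rewrite -(inj_eq eI) pb xb eqxx.
move=> a; apply/idP/idP => [/codomP[i ->]|/codomP[b ->]].
  by have [b ->] := e_inl i; exact: codom_f.
have l0 : (0 < l)%N by apply: leq_trans l3.
have [d ed] := e_inl (Ordinal l0).
apply: (@ordS_ind _ (fun b => inl b \in codom e) d) => //.
by rewrite -ed codom_f.
Qed.

Variable m : nat.
Hypothesis m2 : (2 <= m)%N.

Lemma uends_in_UC : in_UC m n.+3 (n.+3 + c) (ph m (@uends n.+2 c)).
Proof.
have sG := uends_simple.
have l3 := loose_of_gcycle m sG (isT : (3 <= n.+3)%N) uends_cycle.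
split.
- exact: (graph_ph_connected sG (inl ord0) uends_connected).
- exact: ph_linear.
- exact: ph_uniform.
split.
- exists [set ph_edge m (@uends n.+2 c) (inl i) | i : 'I_n.+3]; split.
    by exists n.+3.
  move=> S [l /(gcycle_of_loose sG)[l3' [v [e [ve ->]]]]].
  have codomE := uends_cycle_uniq l3' ve.
  apply/setP => A; apply/imsetP/imsetP => -[i _ ->].
    have : inl i \in codom e by rewrite codomE codom_f.
    by case/codomP => j ->; exists j.
  have : e i \in codom (@inl 'I_n.+3 'I_c) by rewrite -codomE codom_f.
  by case/codomP => j ->; exists j.
- exact: ph_in_powers.
- by rewrite card_hedge_ph // card_sum !card_ord.
- by eexists; exact: l3.
Qed.

Notation UC1 := (UC1_hg m n.+3 c).

Let pend (j : 'I_c) : {v : C_L m n.+3 & 'I_(match v with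
    inl i => if val i == 0%N then c else 0%N | inr _ => 0%N end)} :=
  existT _ (inl ord0) j.

Let pend_inj : injective pend.
Proof. by move=> i j /eqP; rewrite eq_Tagged => /eqP. Qed.

Let pend_surj p : exists j, p = pend j.
Proof.
case: p => [[i|x] j]; last by case: j.
case: i j => [[|i] lt] j; last by case: j.
by exists j; rewrite /pend; move: j; rewrite (bool_irrelevance lt (ltn0Sn n.+2)).
Qed.

Let t0_subproof : (0 < m - 1)%N. Proof. by lia. Qed.
Let tS_subproof (t : 'I_(m - 2)) : (t.+1 < m - 1)%N.
Proof. by have := ltn_ord t; lia. Qed.

(** An attached edge has $m-1$ interchangeable new vertices: number 0 plays the pendant graph vertex
    and number $t+1$ the added vertex $t$. *)
Let f (u : ph_vert m I I) : UC1 :=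
  match u with
  | inl (inl i) => inl (inl i)
  | inr (inl i, t) => inl (inr (i, t))
  | inl (inr j) => inr (pend j, Ordinal t0_subproof)
  | inr (inr j, t) => inr (pend j, Ordinal (tS_subproof t))
  end.

Let pr1 j (u : UC1) := match u with inr p => p.1 | inl _ => pend j end.
Let pr2 (u : UC1) := match u with inr p => val p.2 | inl _ => 0%N end.

Let f_inj : injective f.
Proof.
move=> [[i|j]|[[i|j] t]] [[i'|j']|[[i'|j'] t']] //= ff.
- by case: ff => ->.
- by have /pend_inj -> := congr1 (pr1 j) ff.
- by case: ff => -> ->.
- have /pend_inj -> := congr1 (pr1 j) ff.
  by have /= [/val_inj ->] := congr1 pr2 ff.
Qed.

Let f_surj u : exists x, u = f x.
Proof.
case: u => [[i|[i t]]|[p t]]; first by exists (inl (inl i)).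
  by exists (inr (inl i, t)).
have [j ->] := pend_surj p; case: t => [[|t] lt].
  by exists (inl (inr j)) => /=; congr (inr (_, _)); apply: val_inj.
have t_lt : (t < m - 2)%N by lia.
by exists (inr (inr j, Ordinal t_lt)); congr (inr (_, _)); apply: val_inj.
Qed.

Let f_cycle i : f @: ph_edge m (@uends n.+2 c) (inl i) =
  [set inl v | v in lc_edge m i].
Proof.
apply/setP => u; have [x ->] := f_surj u; rewrite mem_imset //.
have inl_inj : injective (@inl (C_L m n.+3) ({v : C_L m n.+3 & 'I_(match v with
    inl i => if val i == 0%N then c else 0%N | inr _ => 0%N end)} * 'I_(m - 1))).
  by move=> ? ? [].
case: x => [[i'|j]|[[i'|j] t]]; rewrite mem_ph_edge /=.
- rewrite mem_imset // !inE; case: imsetP => [[]|] //; by rewrite orbF.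
- by rewrite !inE /=; apply/esym/imsetP => -[].
- rewrite mem_imset // !inE /=; apply/eqP/imsetP => [[->]|[? _ [-> _]] //].
  by exists t.
- by apply/esym/imsetP => -[].
Qed.

Let f_pend j : f @: ph_edge m (@uends n.+2 c) (inr j) = att_edge m (pend j).
Proof.
apply/setP => u; have [x ->] := f_surj u; rewrite mem_imset //.
case: x => [[i'|j']|[[i'|j'] t]]; rewrite mem_ph_edge /=.
- rewrite !inE /=; case: imsetP => [[]|] //; by rewrite orbF.
- rewrite !inE /=; apply/eqP/imsetP => [[->]|[? _ /(congr1 (pr1 j)) /= /pend_inj ->] //].
  by exists (Ordinal t0_subproof).
- by rewrite !inE /=; apply/esym/imsetP => -[].
- rewrite !inE /=; apply/eqP/imsetP => [[->]|[? _ /(congr1 (pr1 j)) /= /pend_inj ->] //].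
  by exists (Ordinal (tS_subproof t)).
Qed.

Lemma uends_UC1 : hiso (ph m (@uends n.+2 c)) UC1.
Proof.
exists f.
  have /fin_all_exists[g gK] u : exists x, u = f x by exact: f_surj.
  by exists g => x; [apply: f_inj; rewrite -gK | rewrite -gK].
move=> A; have memA := @mem_hedge_ph m _ _ _ uends_simple A.
apply/idP/idP => [/memA[[i|j] ->]|].
- rewrite f_cycle; apply/setUP; left; apply/imsetP; exists (lc_edge m i) => //.
  exact: imset_f.
- by rewrite f_pend; apply/setUP; right; apply: imset_f.
case/setUP => /imsetP.
  move=> [_ /imsetP[i _ ->]]; rewrite -f_cycle => /(imset_inj f_inj) ->.
  by apply/(mem_hedge_ph uends_simple); exists (inl i).
move=> [p _]; have [j ->] := pend_surj p; rewrite -f_pend => /(imset_inj f_inj) ->.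
by apply/(mem_hedge_ph uends_simple); exists (inr j).
Qed.
End CanonicalUnicyclic.

Lemma UC1_C_L m l : hiso (UC1_hg m l 0) (C_L m l).
Proof.
have no_pend (p : {v : C_L m l & 'I_(match v with
    inl i => if val i == 0%N then 0%N else 0%N | inr _ => 0%N end)}) : False.
  by case: p => [[i|x] [j]] //=; case: ifP.
apply: hiso_sym; exists inl.
  exists (fun u : UC1_hg m l 0 =>
    match u with inl x => x | inr p => match no_pend p.1 with end end) => //.
  by move=> [x|[p t]] //; case: (no_pend p).
have inlI : injective (@inl (C_L m l) ({v : C_L m l & 'I_(match v with
    inl i => if val i == 0%N then 0%N else 0%N | inr _ => 0%N end)} * 'I_(m - 1))).
  by move=> ? ? [].
move=> A; apply/idP/setUP => [A_in|[/imsetP[B B_in /(imset_inj inlI) ->] //|]].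
  by left; apply: imset_f.
by case/imsetP => p; case: (no_pend p).
Qed.

(** * Extremality *)

Lemma simple_ends_image (V V' E E' : finType) (ends : E -> {set V})
    (ends' : E' -> {set V'}) (phi : V -> V') (psi : E -> E') :
  injective phi -> bijective psi -> (forall e, ends' (psi e) = phi @: ends e) ->
  simple_ends ends -> simple_ends ends'.
Proof.
move=> phiI [g psiK gK] endsE [c2 eI].
have endsE' e : ends' e = phi @: ends (g e) by rewrite -endsE gK.
split=> [e|e f]; first by rewrite endsE' card_imset.
by rewrite !endsE' => /(imset_inj phiI)/eI/(can_inj gK).
Qed.

Lemma in_UC_graph m l k U : in_UC m l k U ->
  exists (V E : finType) (ends : E -> {set V}),
  [/\ simple_ends ends, hiso U (ph m ends), #|E| = k &
   (3 <= l)%N /\ exists (v : 'I_l -> V) (e : 'I_l -> E), gcycle ends v e /\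
     forall l' (v' : 'I_l' -> V) (e' : 'I_l' -> E), (3 <= l')%N ->
       gcycle ends v' e' -> forall i, exists j, e i = e' j].
Proof.
move=> [_ _ _ [Hun [G [G2 isoG]] cardE [S lS]]].
have sG := graph_ends_simple G2.
have iso : hiso U (ph m (@graph_ends G)).
  exact: hiso_trans isoG (power_hg_ph m G2).
have [f bf fE] := iso.
have [l3 [v [e [ve _]]]] := gcycle_of_loose sG (loose_cycle_iso bf fE lS).
exists G, {e : {set G} | e \in hedge G}, (@graph_ends G); split=> //.
  by rewrite -cardE -(hiso_card_hedge iso) card_hedge_ph.
split=> //; exists v, e; split=> // l' v' e' l3'.
exact: (ph_unicyclicP sG (hiso_unicyclic iso Hun) l3 l3' ve).
Qed.

Section NormalForm.
Variables (R : realType) (m n c : nat) (U : hypergraph).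
Hypotheses (m2 : (2 <= m)%N) (U_UC : in_UC m n.+3 (n.+3 + c) U).
Notation I := ('I_n.+3 + 'I_c)%type.

(* [w = inl 0] carries the maximum of a Perron vector over the vertices of the
   underlying graph. *)
Lemma UC_normal_form : exists (ends : I -> {set I}) (X : ph_vert m I I -> R),
  [/\ simple_ends ends /\ hiso U (ph m ends), forall u, 0 < X u,
      forall u, adjop (X : ph m ends -> R) u = mu R m (ph m ends) * X u,
      forall a, X (inl a) <= X (inl (inl ord0)) &
      forall a, ends a = uends a \/ exists p, [/\ p \in ends a,
        inl ord0 \notin ends a & uends a = inl ord0 |: (ends a :\ p)]].
Proof.
have [V [E [ends [sG iso cardE [_ [v [e [ve uni]]]]]]]] := in_UC_graph U_UC.
have Hc : connected_hg (ph m ends) by case: U_UC => Hc *; apply: hiso_connected Hc.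
have H0 : (0 < #|ph m ends|)%N by apply/card_gt0P; exists (inl (v ord0)).
have [X [X0 XA]] := perron R m2 H0 Hc.
pose w := [arg max_(x > v ord0) X (inl x)]%O.
have wmax x : X (inl x) <= X (inl w).
  by rewrite /w; case: arg_maxP => // y _; apply.
have Gc := ph_connected_graph sG Hc.
have [phi [psi [phi_bij psi_bij phi0 psiE]]] :=
  unicyclic_structure sG Gc ve uni w cardE.
have phiI := bij_inj phi_bij; have [phi' phiK phiK'] := phi_bij.
have phi'I := can_inj phiK'.
(* The graph of [U] is relabelled over the vertex and edge types of [uends], so that the two compare
   edge by edge. *)
pose ends' a := phi' @: ends (psi a).
have endsE a : ends (psi a) = phi @: ends' a by rewrite imset_can.
have [psi' psiK psiK'] := psi_bij.
have sG' : simple_ends ends'.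
  apply: (simple_ends_image (psi := psi') phi'I) sG; first by exists psi.
  by move=> f; rewrite /ends' psiK'.
have [F Fbij FE] : exists2 F : ph m ends' -> ph m ends, bijective F &
    (forall a, F (inl a) = inl (phi a)) /\
    forall A : {set ph m ends'}, (A \in hedge (ph m ends')) = (F @: A \in hedge (ph m ends)).
  exists (@ph_map m _ _ _ _ ends' ends phi psi); first exact: ph_map_bij.
  by split=> // A; apply: ph_map_hedge.
have iso' : hiso U (ph m ends').
  by apply: hiso_trans iso (hiso_sym _); exists F => //; case: FE.
exists ends', (X \o F); split=> //.
- by move=> u; apply: X0.
- move=> u; rewrite adjop_iso //; last by case: FE.
  rewrite XA /mu; congr (_ * _ * _); apply: hiso_lambda1 => //.
  exact: hiso_trans (hiso_sym iso) iso'.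
- by move=> a; rewrite /= !FE.1 phi0.
- move=> a; have wE : phi' w = inl ord0 by rewrite -phi0 phiK.
  case: (psiE a) => [E'|[p [pe we E']]]; [left | right; exists (phi' p)].
    by rewrite /ends' E' imset_can.
  rewrite -wE /ends' !mem_imset //; split=> //.
  rewrite -[LHS](imset_can _ phiK) E' imsetU1; congr (_ |: _).
  apply/setP => x; rewrite -[x]phiK mem_imset // !in_setD1 mem_imset //.
  by rewrite (inj_eq phi'I).
Qed.

Lemma UC_connected (H : hypergraph) : hiso U H -> connected_hg H.
Proof. by case: U_UC => Hc *; apply: hiso_connected Hc. Qed.

Lemma UC_lambda1 (H : hypergraph) : hiso U H -> lambda1 R m U = lambda1 R m H.
Proof.
move=> iso; have iso' := hiso_sym iso; apply/esym/hiso_lambda1 => //; last exact: UC_connected.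
have [ends [_ [[_ isoE] _ _ _ _]]] := UC_normal_form.
have [f _ _] := hiso_trans (hiso_sym isoE) iso.
by apply/card_gt0P; exists (f (inl (inl ord0))).
Qed.
End NormalForm.

Lemma lambda1_le_mu (R : realType) m (H K : hypergraph) : (2 <= m)%N ->
  (lambda1 R m H <= lambda1 R m K) = (mu R m H <= mu R m K).
Proof. by move=> m2; rewrite ler_pM2l // subr_gt0 ltr1n. Qed.

Section Extremal.
Variables (R : realType) (m n : nat).
Hypothesis m2 : (2 <= m)%N.

Lemma UC1_in_UC c : in_UC m n.+3 (n.+3 + c) (UC1_hg m n.+3 c).
Proof. exact: hiso_in_UC (uends_UC1 n c m2) (uends_in_UC n c m2). Qed.

Lemma lambda1_UC1 c : lambda1 R m (UC1_hg m n.+3 c) = lambda1 R m (ph m (@uends n.+2 c)).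
Proof. exact: (UC_lambda1 R m2 (UC1_in_UC c) (hiso_sym (uends_UC1 n c m2))). Qed.

Lemma ph_uends_connected c : connected_hg (ph m (@uends n.+2 c)).
Proof. by case: (uends_in_UC n c m2). Qed.

Lemma UC_extremal c (U : hypergraph) : in_UC m n.+3 (n.+3 + c) U ->
  lambda1 R m U <= lambda1 R m (UC1_hg m n.+3 c) /\
  (lambda1 R m U = lambda1 R m (UC1_hg m n.+3 c) -> hiso U (UC1_hg m n.+3 c)).
Proof.
move=> U_UC; have [ends [X [[sG iso] X0 XA Xmax endsE]]] := UC_normal_form R m2 U_UC.
have mv a : uends a = ends a \/ moved ends (@uends n.+2 c) X (inl ord0) a.
  case: (endsE a) => [->|[p [pe we E']]]; first by left.
  by right; exists p.
rewrite (UC_lambda1 R m2 U_UC iso) lambda1_UC1; split.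
  rewrite (lambda1_le_mu _ _ _ m2).
  exact: (transfer_le m2 sG (uends_simple n c) (@ph_uends_connected c) X0 XA mv).
move=> eq_l; apply: hiso_trans iso _; apply: hiso_trans (uends_UC1 n c m2).
apply: (@ph_hiso m _ _ _ _ _ _ id id); [by exists id | by exists id |].
move=> a; rewrite imset_id.
apply: (transfer_eq m2 sG (uends_simple n c) (@ph_uends_connected c) X0 XA mv).
by rewrite /mu eq_l.
Qed.
End Extremal.

(** * Shortening the cycle by one edge *)

Section ShorterCycle.
Variables (R : realType) (m n c : nat).
Hypothesis m2 : (2 <= m)%N.
Notation I := ('I_n.+4 + 'I_c)%type.

Let o1 : 'I_n.+4 := lift ord0 ord0.
Let o2 : 'I_n.+4 := ordS o1.

(** Redirecting the second cycle edge from [o1] to [ord0] takes [o1] off the cycle; the first cycle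
    edge becomes a pendant edge at [ord0] ending in [o1], as [phi] and [psi] record. *)
Definition shortcut (a : I) : {set I} :=
  if a == inl o1 then [set inl ord0; inl o2] else uends a.

Let phi (b : 'I_n.+3 + 'I_c.+1) : I :=
  match b with
  | inl i => inl (lift o1 i)
  | inr j => if unlift ord0 j is Some j' then inr j' else inl o1
  end.

Let psi (b : 'I_n.+3 + 'I_c.+1) : I :=
  match b with
  | inl i => inl (lift ord0 i)
  | inr j => if unlift ord0 j is Some j' then inr j' else inl ord0
  end.

Let glue_bij (h : 'I_n.+4) :
  bijective (fun b : 'I_n.+3 + 'I_c.+1 => match b with
    | inl i => inl (lift h i)
    | inr j => if unlift ord0 j is Some j' then inr j' else inl h
    end : I).
Proof.
exists (fun a : I => match a with
  | inl i => if unlift h i is Some i' then inl i' else inr ord0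
  | inr j => inr (lift ord0 j) end).
- move=> [i|j]; first by rewrite liftK.
  by case: (unliftP ord0 j) => [j'|] /= -> //; rewrite unlift_none.
- move=> [i|j]; last by rewrite liftK.
  by case: (unliftP h i) => [i'|] /= -> //; rewrite unlift_none.
Qed.

Let shortcutE b : shortcut (psi b) = phi @: uends b.
Proof.
case: b => [i|j]; rewrite /shortcut /= imsetU !imset_set1 /=; last first.
  have l0 : lift o1 ord0 = ord0 by apply: val_inj.
  case: unliftP => [j' _|_]; rewrite l0 //=.
  by congr [set _; inl _]; apply: val_inj.
have -> : (inl (lift ord0 i) == inl o1 :> I) = (i == ord0).
  by rewrite -[LHS]/(lift ord0 i == lift ord0 ord0) (inj_eq lift_inj).
have [->|iN] := eqVneq i ord0.
  by congr [set inl _; inl _]; apply: val_inj.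
have i_gt0 : (0 < i)%N by rewrite lt0n; apply: contraNneq iN => i0; apply/eqP/val_inj.
congr [set inl _; inl _]; apply: ord_inj; rewrite ?lift0 /= /bump.
  by rewrite i_gt0.
have := ltn_ord i; rewrite leq_eqVlt => /orP[/eqP[iE]|lt_i].
  by rewrite iE !modnn.
by rewrite !modn_small.
Qed.

Lemma shortcut_iso : hiso (ph m (@uends n.+2 c.+1)) (ph m shortcut).
Proof. exact: (ph_hiso _ (glue_bij o1) (glue_bij ord0) shortcutE). Qed.

Lemma shortcut_simple : simple_ends shortcut.
Proof.
exact: (simple_ends_image (bij_inj (glue_bij o1)) (glue_bij ord0) shortcutE (uends_simple n c.+1)).
Qed.

(** The moves of the normal form and the shortcut are made in one transfer from [ends] to
    [shortcut]; it is strict since edge [inl o1] really changes. *)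
Lemma UC_lt_shorter (U : hypergraph) : in_UC m n.+4 (n.+4 + c) U ->
  lambda1 R m U < lambda1 R m (UC1_hg m n.+3 c.+1).
Proof.
move=> U_UC; have [ends [X [[sG iso] X0 XA Xmax endsE]]] := UC_normal_form R m2 U_UC.
have cS := hiso_connected shortcut_iso (@ph_uends_connected m n m2 c.+1).
(* A moved edge would contain [inl ord0] in [uends], which this edge does not. *)
have E1 : ends (inl o1) = uends (inl o1).
  case: (endsE (inl o1)) => // -[p [_ _ /setP/(_ (inl ord0))]].
  by rewrite !inE eqxx.
have mv a : shortcut a = ends a \/ moved ends shortcut X (inl ord0) a.
  rewrite /shortcut; case: eqP => [->|aN].
    right; exists (inl o1); rewrite /shortcut eqxx E1 !inE eqxx; split=> //.
    apply/setP => x; rewrite !inE; case: eqP => //= _.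
    by have [->|//] := eqVneq x (inl o1).
  case: (endsE a) => [->|[p [pe we E']]]; first by left.
  right; exists p; split => //; rewrite /shortcut.
  by case: eqP.
rewrite (UC_lambda1 R m2 U_UC iso) lambda1_UC1 //.
have -> : lambda1 R m (ph m (@uends n.+2 c.+1)) = lambda1 R m (ph m shortcut).
  exact: (UC_lambda1 R m2 (uends_in_UC n c.+1 m2) shortcut_iso).
rewrite lt_neqAle (lambda1_le_mu _ _ _ m2) andbC.
rewrite (transfer_le m2 sG shortcut_simple cS X0 XA mv) /=.
apply/eqP => eq_l.
have /(_ (inl o1)) := transfer_eq m2 sG shortcut_simple cS X0 XA mv (congr1 _ eq_l).
by rewrite E1 /shortcut eqxx => /setP/(_ (inl ord0)); rewrite !inE eqxx.
Qed.
End ShorterCycle.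

(** * Explicit bounds *)

Section Bounds.
Variables (R : realType) (m n c : nat).
Hypothesis m2 : (2 <= m)%N.
Notation I := ('I_n.+3 + 'I_c)%type.
Notation H := (ph m (@uends n.+2 c)).
Notation M := (m%:R : R).
Notation N := (n.+3%:R + c%:R : R).

Let sG := uends_simple n c.
Let cH : connected_hg H. Proof. exact: ph_uends_connected. Qed.
Let H0 : (0 < #|H|)%N. Proof. by apply/card_gt0P; exists (inl (inl ord0)). Qed.
Let M2 : 2 <= M. Proof. by rewrite ler_nat. Qed.

Lemma sum_incident_core (F : I -> R) i :
  \sum_(a | inl i \in uends a) F a = F (inl i) + F (inl (ord_pred i)) +
    (if i == ord0 then \sum_j F (inr j) else 0).
Proof.
have inlI : injective (@inl 'I_n.+3 'I_c) by move=> ? ? [].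
have pN : ord_pred i != i.
  by apply/eqP => pi; have := ordS_neq (isT : (3 <= n.+3)%N) i; rewrite -{1}pi ord_predK eqxx.
rewrite big_sumType /=; congr (_ + _).
  rewrite (bigD1 i) ?inE ?eqxx //= (bigD1 (ord_pred i)) /=; last first.
    by rewrite !inE ord_predK eqxx orbT.
  rewrite big1 ?addr0 // => j /andP[/andP[]]; rewrite !inE !(inj_eq inlI).
  move=> /orP[/eqP->|/eqP->]; first by rewrite eqxx.
  by rewrite ordSK eqxx.
case: (eqVneq i ord0) => [->|iN].
  by apply: eq_bigl => j; rewrite !inE eqxx.
by rewrite big_pred0 // => j; rewrite !inE (inj_eq inlI) (negPf iN).
Qed.

Lemma sum_incident_pendant (F : I -> R) j :
  \sum_(a | inr j \in uends a) F a = F (inr j).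
Proof.
apply: big_pred1 => -[i|j'] /=; rewrite !inE //=.
Qed.

Lemma adjop_inl (X : H -> R) v : adjop X (inl v) =
  \sum_(a | v \in uends a) (\sum_(u in ph_edge m (@uends n.+2 c) a) X u - X (inl v)).
Proof. by rewrite adjop_ph //; apply: eq_bigl => a; rewrite mem_ph_edge. Qed.

Lemma adjop_inr (X : H -> R) a t : adjop X (inr (a, t)) =
  \sum_(u in ph_edge m (@uends n.+2 c) a) X u - X (inr (a, t)).
Proof. by rewrite adjop_ph //; apply: big_pred1 => b; rewrite mem_ph_edge eq_sym. Qed.

Lemma edge_sum_cycle (X : H -> R) i :
  \sum_(u in ph_edge m (@uends n.+2 c) (inl i)) X u =
  X (inl (inl i)) + X (inl (inl (ordS i))) + \sum_t X (inr (inl i, t)).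
Proof.
rewrite ph_edge_sum; congr (_ + _); rewrite big_setU1 ?big_set1 // !inE.
by apply/eqP => -[/esym/eqP]; exact/negP/ordS_neq.
Qed.

Lemma edge_sum_pendant (X : H -> R) j :
  \sum_(u in ph_edge m (@uends n.+2 c) (inr j)) X u =
  X (inl (inl ord0)) + X (inl (inr j)) + \sum_t X (inr (inr j, t)).
Proof. by rewrite ph_edge_sum; congr (_ + _); rewrite big_setU1 ?big_set1 // !inE. Qed.

Let sum_inner (x : R) : \sum_(t < m - 2) x = (M - 2) * x.
Proof. by rewrite sumr_const card_ord -[LHS]mulr_natl natrB. Qed.

(** [r] is the radius of the loose cycle: the quadratic results from eliminating [y] between
    $ry=2+(M-3)y$ at added vertices and $r=2(1+(M-2)y)$ at core vertices. *)
Lemma mu_lower (r : R) : 0 < r -> r ^+ 2 = (M - 1) * r + 2 * (M - 1) ->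
  r <= mu R m H /\ (r = mu R m H -> c = 0).
Proof.
move=> r0 rE.
have r_gt : M - 1 < r by have := M2; nra.
have q0 : r - M + 3 != 0 by rewrite gt_eqF //; lra.
pose y := 2 / (r - M + 3).
have yq : y * (r - M + 3) = 2 by rewrite divfK.
have ry : r * y = 2 + (M - 3) * y by lra.
have rE2 : r = 2 * (1 + (M - 2) * y).
  apply: (mulIf q0).
  transitivity (2 * (r - M + 3) + 2 * (M - 2) * (y * (r - M + 3))); last by ring.
  by rewrite yq; lra.
pose X : H -> R := fun u => if u is inl _ then 1 else y.
have SE a : \sum_(u in ph_edge m (@uends n.+2 c) a) X u = 2 + (M - 2) * y.
  by case: a => [i|j]; rewrite ?edge_sum_cycle ?edge_sum_pendant /= sum_inner.
have SE2 a : \sum_(u in ph_edge m (@uends n.+2 c) a) X u ^+ 2 = 2 + (M - 2) * y ^+ 2.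
  pose X2 u := X u ^+ 2.
  by case: a => [i|j]; rewrite ?(edge_sum_cycle X2) ?(edge_sum_pendant X2) /X2 /=
    sum_inner !expr1n.
have sumI (x : R) : \sum_(a : I) x = N * x.
  by rewrite sumr_const card_sum !card_ord -[LHS]mulr_natl natrD.
have norm : \sum_(u : ph_vert m I I) X u ^+ 2 = N * (1 + (M - 2) * y ^+ 2).
  rewrite big_sumType /= sumI expr1n mulrDr mulr1; congr (_ + _).
  rewrite -(pair_bigA _ (fun _ _ => y ^+ 2)) /=.
  by under eq_bigr do rewrite sum_inner; rewrite sumI.
have N0 : 0 < N by rewrite -natrD ltr0n.
have key : \sum_u X u * adjop X u = r * \sum_(u : H) X u ^+ 2.
  rewrite quad_ph // [\sum_(u : H) _]norm.
  under eq_bigr do rewrite SE SE2.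
  rewrite sumI [RHS]mulrCA; congr (_ * _).
  transitivity (r + (M - 2) * y * (r * y)); last by ring.
  rewrite ry {1}rE2; ring.
have norm0 : 0 < \sum_(u : H) X u ^+ 2.
  rewrite [X in _ < X]norm; apply: mulr_gt0 N0 _; apply: ltr_pwDl => //.
  by apply: mulr_ge0; [rewrite subr_ge0 | exact: sqr_ge0].
split.
  by rewrite -(ler_pM2r norm0) -key; apply: rayleigh.
(* At a pendant vertex the neighbours sum to $1+(M-2)y=r/2$ where the eigenvalue equation demands
   $r$. *)
move=> r_mu; apply/eqP; rewrite -leqn0 leqNgt; apply/negP => c0.
have := rayleigh_eq m2 H0 cH (X := X); rewrite key r_mu => /(_ erefl)/(_ (inl (inr (Ordinal c0)))).
rewrite adjop_inl sum_incident_pendant SE /= -r_mu; move: rE2 r0; lra.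
Qed.

(** The star at the centre has $c+2$ edges. With 1 on its leaves, their equation gives the hub value
    $t=r-M+2$, and the hub equation is the hypothesis. Extended by 0, this is a subsolution. *)
Lemma mu_gt_star (r : R) : 0 < r - M + 2 ->
  r * (r - M + 2) = (c%:R + 2) * (M - 1) -> r < mu R m H.
Proof.
set t := r - M + 2 => t0 rt.
have r0 : 0 <= r.
  rewrite -(pmulr_lge0 _ t0) rt; apply: mulr_ge0; first exact: addr_ge0.
  by rewrite subr_ge0 ler1n (leq_trans _ m2).
pose h (a : I) := inl ord0 \in uends a.
pose X : H -> R := fun u => match u with
  | inl v => if v == inl ord0 then t else [exists a, h a && (v \in uends a)]%:R
  | inr (a, _) => (h a)%:R end.
have Xhub : X (inl (inl ord0)) = t by rewrite /X eqxx.
have X0 u : 0 <= X u.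
  by rewrite /X; case: u => [v|[a s]]; [case: ifP => _; [exact: ltW | exact: ler0n] | exact: ler0n].
pose S a := \sum_(u in ph_edge m (@uends n.+2 c) a) X u.
have S_ge a u : u \in ph_edge m (@uends n.+2 c) a -> 0 <= S a - X u.
  by move=> ua; rewrite /S (bigD1 u) //= addrAC subrr add0r sumr_ge0.
have X1 a u : h a -> u \in ph_edge m (@uends n.+2 c) a -> u != inl (inl ord0) -> X u = 1.
  case: u => [v|[b s]] ha; rewrite mem_ph_edge /X; last by move=> /eqP ->; rewrite ha.
  move=> va /negPf vN; rewrite (_ : (v == inl ord0) = false); last first.
    by apply/eqP => vE; rewrite vE eqxx in vN.
  by case: existsP => // -[]; exists a; rewrite ha.
have Sh a : h a -> S a = t + (M - 1).
  move=> ha; rewrite /S (bigD1 (inl (inl ord0))) /=; last by rewrite mem_ph_edge.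
  congr (_ + _); rewrite (eq_bigr (fun=> 1)); last first.
    by move=> u /andP[]; apply: X1.
  rewrite sumr_const (_ : #|_| = #|ph_edge m (@uends n.+2 c) a| .-1).
    rewrite (ph_uniform m2 sG); last by apply/(mem_hedge_ph sG); exists a.
    by rewrite -subn1 natrB //; apply: leq_trans m2.
  rewrite [in RHS](cardD1 (inl (inl ord0))) mem_ph_edge -/(h a) ha /=.
  by apply: eq_card => u; rewrite [RHS]inE /= unfold_in andbC.
have star u : u != inl (inl ord0) -> forall a, h a -> u \in ph_edge m (@uends n.+2 c) a ->
    r * X u = S a - X u.
  by move=> uN a ha ua; rewrite (X1 a) // Sh // /t; lra.
have adjE u : adjop X u = \sum_(a | u \in ph_edge m (@uends n.+2 c) a) (S a - X u).
  by rewrite adjop_ph.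
have XN0 u : u != inl (inl ord0) -> X u != 0 ->
    exists2 a, h a & u \in ph_edge m (@uends n.+2 c) a.
  rewrite /X; case: u => [v|[b s]] uN.
    rewrite (_ : (v == inl ord0) = false); last first.
      by apply/eqP => vE; rewrite vE eqxx in uN.
    case: existsP => [[a /andP[ha va]] _|_]; last by rewrite eqxx.
    by exists a; rewrite ?mem_ph_edge.
  case hb : (h b); last by rewrite eqxx.
  by exists b; rewrite ?mem_ph_edge.
have hub : adjop X (inl (inl ord0)) = r * X (inl (inl ord0)).
  rewrite adjop_inl (eq_bigr (fun=> M - 1)); last first.
    by move=> a ha; rewrite -/(S a) Sh // Xhub addrAC subrr add0r.
  by rewrite sum_incident_core eqxx sumr_const card_ord Xhub rt -[_ *+ c]mulr_natl; ring.
(* Strictness is sought at [two]: its edge to [one] misses the hub, yet [one] has value 1. *)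
pose one : 'I_n.+3 := lift ord0 ord0.
pose two : 'I_n.+3 := ordS one.
pose b : H := inl (inl two).
have bN : b != inl (inl ord0) by [].
have b1 : b \in ph_edge m (@uends n.+2 c) (inl one) by rewrite mem_ph_edge !inE eqxx orbT.
have Sb : 1 <= S (inl one) - X b.
  have one0 : X (inl (inl one)) = 1.
    apply: (X1 (inl ord0)); rewrite ?/h ?mem_ph_edge ?inE ?eqxx //.
  rewrite /S (bigD1 b) // addrAC subrr add0r (bigD1 (inl (inl one))).
    by rewrite one0 lerDl sumr_ge0.
  by rewrite mem_ph_edge !inE eqxx.
have {}Sb : 0 < S (inl one) - X b by apply: lt_le_trans Sb; exact: ltr01.
apply: (mu_gt_sub m2 H0 cH (X := X) (u0 := b)) => // [u|].
  have [->|uN] := eqVneq u (inl (inl ord0)); first by rewrite hub.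
  rewrite adjE; have [->|/(XN0 u uN)[a ha ua]] := eqVneq (X u) 0.
    by rewrite mulr0 sumr_ge0 // => a ua; rewrite subr0 /S sumr_ge0.
  by rewrite (bigD1 a) //= (star u uN a) // lerDl sumr_ge0 // => d /andP[/S_ge].
(* [X b] is nonzero exactly for a triangle, where [two] is also a neighbour of the hub; the edge
   [inl one] is then a surplus beyond the star equation. *)
rewrite adjE; have [X0b|/(XN0 b bN)[a ha ba]] := eqVneq (X b) 0.
  have -> : r * X b = 0 by rewrite X0b mulr0.
  rewrite (bigD1 (inl one)) // ltr_pwDl ?sumr_ge0 //.
  by move=> d /andP[/S_ge].
rewrite (bigD1 a) //= (star b bN a) // ltrDl (bigD1 (inl one)) /=; last first.
  by rewrite b1 /=; apply: contraTneq ha => <-; rewrite /h !inE.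
rewrite ltr_pwDl ?sumr_ge0 //.
by move=> d /andP[/andP[/S_ge]].
Qed.

(** With 1 on the core, [p] and [y] are solved from the equations on pendant edges and at added
    cycle vertices, so only core vertices can fail, and the hub is the worst of them. *)
Lemma mu_lt_upper (r : R) : M < r -> r * (r - M) = (c%:R + 2) * (M - 1) ->
  mu R m H < r.
Proof.
move=> rM rE.
have c0 : 0 <= c%:R :> R by [].
have q2 : r - M + 2 != 0 by rewrite gt_eqF //; lra.
have q3 : r - M + 3 != 0 by rewrite gt_eqF //; lra.
pose p := 1 / (r - M + 2); pose y := 2 / (r - M + 3).
have p0 : 0 < p by rewrite divr_gt0 //; lra.
have y0 : 0 < y by rewrite divr_gt0 //; lra.
have pE : 1 + (M - 2) * p = r * p.
  have : p * (r - M + 2) = 1 by rewrite divfK.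
  by lra.
have yE : 2 + (M - 3) * y = r * y.
  have : y * (r - M + 3) = 2 by rewrite divfK.
  by lra.
pose X : H -> R := fun u => match u with
  | inl (inl _) => 1 | inl (inr _) => p
  | inr (inl _, _) => y | inr (inr _, _) => p end.
(* The hypothesis eliminates $c(M-1)$, which leaves an explicit positive gap. *)
have hub : 2 * (1 + (M - 2) * y) + c%:R * ((M - 1) * p) < r.
  rewrite -subr_gt0.
  have -> : r - (2 * (1 + (M - 2) * y) + c%:R * ((M - 1) * p)) =
      (4 * M + 2 * (r - M) - 2) / ((r - M + 2) * (r - M + 3)).
    have -> : c%:R * ((M - 1) * p) = (r * (r - M) - 2 * (M - 1)) * p by rewrite rE; ring.
    by rewrite /p /y; field; rewrite q2 q3.
  by rewrite divr_gt0 ?mulr_gt0 //; have := M2; lra.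
have core i : adjop X (inl (inl i)) = 2 * (1 + (M - 2) * y) +
    (if i == ord0 then c%:R * ((M - 1) * p) else 0).
  rewrite adjop_inl sum_incident_core; congr (_ + _).
    by rewrite !edge_sum_cycle /= !sum_inner; ring.
  case: ifP => // _; rewrite (eq_bigr (fun=> (M - 1) * p)).
    by rewrite sumr_const card_ord mulr_natl.
  by move=> j _; rewrite edge_sum_pendant /= sum_inner; ring.
have cp : 0 <= c%:R * ((M - 1) * p).
  by rewrite mulr_ge0 // mulr_ge0 ?(ltW p0) //; have := M2; lra.
apply: (mu_lt_super m2 H0 cH (X := X) (u0 := inl (inl ord0))).
- by move=> [[i|j]|[[i|j] t]] /=.
- move=> [[i|j]|[[i|j] t]].
  + rewrite core /= mulr1; case: ifP => _; first exact: ltW.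
    by rewrite addr0; apply: le_trans (ltW hub); rewrite lerDl.
  + by rewrite adjop_inl sum_incident_pendant edge_sum_pendant /= sum_inner -pE; lra.
  + by rewrite adjop_inr edge_sum_cycle /= sum_inner -yE; lra.
  + by rewrite adjop_inr edge_sum_pendant /= sum_inner -pE; lra.
- by rewrite core eqxx /= mulr1.
Qed.
End Bounds.

(** * Closed forms from the quadratic equations *)

Section MainBounds.
Variables (R : realType) (m : nat).
Hypothesis m2 : (2 <= m)%N.
Notation M := (m%:R : R).

Let M2 : 2 <= M. Proof. by rewrite ler_nat. Qed.
Let M1 : 0 < M - 1. Proof. by have := M2; lra. Qed.

Lemma lambda1_mu (H : hypergraph) : lambda1 R m H = mu R m H / (M - 1).
Proof. by rewrite /mu mulrC mulKf // gt_eqF. Qed.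

Lemma lambda1_lower n c :
  let r := (M - 1 + Num.sqrt (M ^+ 2 + 6 * M - 7)) / (2 * M - 2) in
  r <= lambda1 R m (UC1_hg m n.+3 c) /\
  (r = lambda1 R m (UC1_hg m n.+3 c) -> c = 0).
Proof.
rewrite lambda1_UC1 // lambda1_mu.
have M_ge := M2; have M_gt := M1.
have D0 : 0 <= M ^+ 2 + 6 * M - 7 by nra.
have := sqr_sqrtr D0; have := sqrtr_ge0 (M ^+ 2 + 6 * M - 7).
move: (Num.sqrt _) => s s0 sE.
have -> : (M - 1 + s) / (2 * M - 2) = ((M - 1 + s) / 2) / (M - 1).
  by field; rewrite !gt_eqF //; lra.
have [|| le_r eq_r] := @mu_lower R m n c m2 ((M - 1 + s) / 2); [lra | lra |].
split=> [|/(mulIf _) E]; first by rewrite ler_pM2r ?invr_gt0.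
by apply/eq_r/E; rewrite invr_eq0 gt_eqF.
Qed.

Lemma lambda1_gt_star n c :
  (M - 2 + Num.sqrt ((M - 2) ^+ 2 + 4 * (c%:R + 2) * (M - 1))) / (2 * (M - 1))
    < lambda1 R m (UC1_hg m n.+3 c).
Proof.
rewrite lambda1_UC1 // lambda1_mu.
have M_ge := M2; have M_gt := M1.
have c0 : 0 <= c%:R :> R by [].
have D0 : (M - 2) ^+ 2 < (M - 2) ^+ 2 + 4 * (c%:R + 2) * (M - 1).
  by rewrite ltrDl !mulr_gt0 // ltr_pwDr.
have := sqr_sqrtr (ltW (le_lt_trans (sqr_ge0 _) D0)).
(* This makes the hub value $r-M+2$ positive for $r=(M-2+s)/2$. *)
have : M - 2 < Num.sqrt ((M - 2) ^+ 2 + 4 * (c%:R + 2) * (M - 1)).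
  rewrite -[ltLHS]ger0_norm ?subr_ge0 // -sqrtr_sqr ltr_sqrt //.
  exact: le_lt_trans (sqr_ge0 _) D0.
move: (Num.sqrt _) => s s0 sE.
have -> : (M - 2 + s) / (2 * (M - 1)) = ((M - 2 + s) / 2) / (M - 1).
  by field; rewrite gt_eqF.
rewrite ltr_pM2r ?invr_gt0 //; apply: mu_gt_star => //; first lra.
move: sE; move: (c%:R) => x sE.
by lra.
Qed.

Lemma lambda1_lt_upper n c : lambda1 R m (UC1_hg m n.+3 c) <
  (M + Num.sqrt (M ^+ 2 + 4 * (c%:R + 2) * (M - 1))) / (2 * (M - 1)).
Proof.
rewrite lambda1_UC1 // lambda1_mu.
have M_ge := M2; have M_gt := M1.
have c0 : 0 <= c%:R :> R by [].
have D0 : M ^+ 2 < M ^+ 2 + 4 * (c%:R + 2) * (M - 1).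
  by rewrite ltrDl !mulr_gt0 // ltr_pwDr.
have := sqr_sqrtr (ltW (le_lt_trans (sqr_ge0 _) D0)).
have : M < Num.sqrt (M ^+ 2 + 4 * (c%:R + 2) * (M - 1)).
  rewrite -[ltLHS]ger0_norm // -sqrtr_sqr ltr_sqrt //.
  exact: le_lt_trans (sqr_ge0 _) D0.
move: (Num.sqrt _) => s s0 sE.
have -> : (M + s) / (2 * (M - 1)) = ((M + s) / 2) / (M - 1).
  by field; rewrite gt_eqF.
rewrite ltr_pM2r ?invr_gt0 //; apply: mu_lt_upper => //; first lra.
move: sE; move: (c%:R) => x sE.
by lra.
Qed.
End MainBounds.

Theorem theorem3p1p1 (R : realType) (m k : nat) (hm : (2 <= m)%N) (hk : (3 <= k)%N) :
  [/\ (* (i) *)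
      forall l : nat, (3 <= l <= k)%N ->
        [/\ in_UC m l k (UC1_hg m l (k - l)),
            forall U : hypergraph, is_UCstar R m l k U ->
              hiso U (UC1_hg m l (k - l))
          & forall U : hypergraph, in_UC m l k U ->
              ~ hiso U (UC1_hg m l (k - l)) ->
              lambda1 R m U < lambda1 R m (UC1_hg m l (k - l))],
      (* (ii), lower bound *)
      forall (l : nat) (U : hypergraph), (3 <= l <= k)%N -> is_UCstar R m l k U ->
        (m%:R - 1 + Num.sqrt (m%:R ^+ 2 + 6 * m%:R - 7)) / (2 * m%:R - 2)
          <= lambda1 R m U
        /\ ((m%:R - 1 + Num.sqrt (m%:R ^+ 2 + 6 * m%:R - 7)) / (2 * m%:R - 2)
              = lambda1 R m U -> hiso U (C_L m k)),
      (* (ii), monotonicity *)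
      forall (l : nat) (U U' : hypergraph), (4 <= l <= k)%N ->
        is_UCstar R m l k U -> is_UCstar R m (l - 1) k U' ->
        lambda1 R m U < lambda1 R m U'
    & (* (iii) *)
      forall l : nat, (3 <= l <= k)%N ->
        (m%:R - 2 + Num.sqrt ((m%:R - 2) ^+ 2
            + 4 * (k%:R - l%:R + 2) * (m%:R - 1))) / (2 * (m%:R - 1))
          < lambda1 R m (UC1_hg m l (k - l))
        /\ lambda1 R m (UC1_hg m l (k - l))
          < (m%:R + Num.sqrt (m%:R ^+ 2
            + 4 * (k%:R - l%:R + 2) * (m%:R - 1))) / (2 * (m%:R - 1))].
Proof.
have split_l l : (3 <= l <= k)%N -> exists n c, l = n.+3 /\ k = (n.+3 + c)%N.
  case: l => [|[|[|n]]] // /andP[_ lk]; exists n, (k - n.+3)%N.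
  by rewrite subnKC.
have star_le l c U : k = (l.+3 + c)%N -> is_UCstar R m l.+3 k U ->
    lambda1 R m (UC1_hg m l.+3 c) <= lambda1 R m U.
  by move=> -> [_]; apply; apply: UC1_in_UC.
have star_iso l c U : k = (l.+3 + c)%N -> is_UCstar R m l.+3 k U ->
    lambda1 R m U = lambda1 R m (UC1_hg m l.+3 c) /\ hiso U (UC1_hg m l.+3 c).
  move=> kE Ustar; have le_U := star_le _ _ _ kE Ustar.
  case: Ustar; rewrite kE => U_UC _; have [U_le U_iso] := UC_extremal R hm U_UC.
  have eq_U : lambda1 R m U = lambda1 R m (UC1_hg m l.+3 c).
    by apply/eqP; rewrite eq_le U_le.
  by split; last exact: U_iso.
split.
- move=> l /split_l[n [c [-> kE]]]; rewrite [in UC1_hg _ _ _]kE addKn; split.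
  + by rewrite kE; apply: UC1_in_UC.
  + by move=> U /(star_iso _ _ _ kE)[].
  + move=> U; rewrite kE => U_UC nU; have [U_le U_iso] := UC_extremal R hm U_UC.
    by rewrite lt_neqAle U_le andbT; apply/eqP => /U_iso.
- move=> l U /split_l[n [c [-> kE]]] /(star_iso _ _ _ kE)[-> isoU].
  have [le_r eq_r] := lambda1_lower R hm n c; split=> // /eq_r c0.
  move: isoU; rewrite kE c0 addn0 => /hiso_trans; apply; exact: UC1_C_L.
(* [U] is compared with $UC_{l-1}$ carrying one more pendant edge, which the maximal [U'] dominates;
   $l\le k$ provides that edge. *)
- move=> l U U' /andP[l4 lk] Ustar U'star.
  have /split_l[n [c [lE kE]]] : (3 <= l - 1 <= k)%N by apply/andP; split; lia.
  case: c kE => [|c] kE; first by lia.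
  have lE' : l = n.+4 by lia.
  apply: lt_le_trans (star_le _ _ _ kE _); last by rewrite -lE.
  case: Ustar; rewrite lE' kE -[(n.+3 + c.+1)%N]addSnnS => U_UC _.
  exact: UC_lt_shorter U_UC.
- move=> l /split_l[n [c [-> kE]]].
  have -> : k%:R - n.+3%:R + 2 = c%:R + 2 :> R by rewrite kE natrD [n.+3%:R + _]addrC addrK.
  rewrite kE addKn; split; [exact: lambda1_gt_star | exact: lambda1_lt_upper].
Qed.
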